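(* Let $n\ge1$, $Q=2n+2$, $m\in\mathbb{N}$ ($m\ge1$), $1<q<\infty$, $1<q_j<\infty$ and $\alpha_j\in\mathbb{R}$ for $j=1,\dots,m$, with $\frac1q=\frac1{q_1}+\cdots+\frac1{q_m}$ and $\alpha=\alpha_1+\cdots+\alpha_m$. Assume that $-\frac{\alpha_j}{q}-\frac{Q}{q_j}+Q>0$ for every $j=1,\dots,m$ and that $-\frac{\alpha}{q}-\frac{Q}{q}<0$. Then the $m$-linear $n$-dimensional Hilbert operator $\mathcal{H}_3^h$, acting on radial functions $f_j\in L^{q_j}(\mathbb{H}^n,|x|_h^{q_j\alpha_j/q})$, satisfies $$\left\|\mathcal{H}_3^h\right\|_{L^{q_1}(\mathbb{H}^n,|x|_h^{q_1\alpha_1/q})\times\cdots\times L^{q_m}(\mathbb{H}^n,|x|_h^{q_m\alpha_m/q})\to L^q(\mathbb{H}^n,|x|_h^{\alpha})}=\frac{\omega_Q^m\,\Gamma\left(\frac{\alpha+Q}{qQ}\right)\prod_{j=1}^m\Gamma\left(1-\frac{\alpha_j}{qQ}-\frac1{q_j}\right)}{Q^m\,\Gamma(m)}.$$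
   Context: The Heisenberg group $\mathbb{H}^n$ is, as a manifold, $\mathbb{R}^{2n+1}$; its Haar measure is Lebesgue measure $dx$ on $\mathbb{R}^{2n+1}$, its dilations are $\delta_r(x_1,\dots,x_{2n},x_{2n+1})=(rx_1,\dots,rx_{2n},r^2x_{2n+1})$ for $r>0$, and its homogeneous dimension is $Q=2n+2$. The homogeneous norm is $|x|_h=\big[\big(\sum_{i=1}^{2n}x_i^2\big)^2+x_{2n+1}^2\big]^{1/4}$. Put $B(0,1)=\{x:|x|_h<1\}$, $\Omega_Q=|B(0,1)|$ (Lebesgue measure) and $\omega_Q=Q\,\Omega_Q$. A function $f$ on $\mathbb{H}^n$ is radial if $f(x)$ depends only on $|x|_h$. $\Gamma$ is Euler's gamma function. The $m$-linear $n$-dimensional Hilbert operator is $$\mathcal{H}_3^h(f_1,\dots,f_m)(x)=\int_{\mathbb{H}^n}\cdots\int_{\mathbb{H}^n}\frac{f_1(y_1)\cdots f_m(y_m)}{\left(|x|_h^Q+|y_1|_h^Q+\cdots+|y_m|_h^Q\right)^m}\,dy_1\cdots dy_m,\qquad x\in\mathbb{H}^n\setminus\{0\}.$$ For a positive measurable weight $w$ (defined almost everywhere), $\|f\|_{L^p(\mathbb{H}^n,w)}=\big(\int_{\mathbb{H}^n}|f(x)|^pw(x)\,dx\big)^{1/p}$. The operator norm is the supremum of $\|\mathcal{H}_3^h(f_1,\dots,f_m)\|_{L^q(\mathbb{H}^n,|x|_h^{\alpha})}\big/\prod_{j=1}^m\|f_j\|_{L^{q_j}(\mathbb{H}^n,|x|_h^{q_j\alpha_j/q})}$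 over all radial $f_j$ with $0<\|f_j\|_{L^{q_j}(\mathbb{H}^n,|x|_h^{q_j\alpha_j/q})}<\infty$. *)

(* Defs.v *)
From HB Require Import structures.
From mathcomp Require Import all_boot all_order all_algebra.
From mathcomp Require Import all_classical all_reals all_analysis.

Set Implicit Arguments.
Unset Strict Implicit.
Unset Printing Implicit Defensive.

Import Order.TTheory GRing.Theory Num.Theory.
Import numFieldNormedType.Exports.

Local Open Scope classical_set_scope.
Local Open Scope ring_scope.

Section product_power.
Context d (T : measurableType d) (R : realType).
Variable mu : {sigma_finite_measure set T -> \bar R}.

Definition tcons k (p : T * k.-tuple T) : k.+1.-tuple T :=
  [tuple of p.1 :: p.2].

Lemma measurable_tcons k : measurable_fun [set: T * k.-tuple T] (@tcons k).
Proof. exact: measurable_cons. Qed.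

Section step.
Variables (k : nat)
  (nu : {sigma_finite_measure set (k.-tuple T) -> \bar R}).

Definition pow_measure_step : set (k.+1.-tuple T) -> \bar R :=
  pushforward (mu \x nu)%E (@tcons k).

Let preimage_measurable A : measurable A -> measurable (@tcons k @^-1` A).
Proof.
by move=> mA; rewrite -[X in measurable X]setTI; exact: measurable_tcons.
Qed.

Let pow_measure_step0 : pow_measure_step set0 = 0%E.
Proof. by rewrite /pow_measure_step /pushforward preimage_set0 measure0. Qed.

Let pow_measure_step_ge0 A : (0 <= pow_measure_step A)%E.
Proof. by apply: integral_ge0. Qed.

Let pow_measure_step_sigma_additive : semi_sigma_additive pow_measure_step.
Proof.
move=> F mF tF mUF; rewrite /pow_measure_step /pushforward preimage_bigcup.
apply: measure_semi_sigma_additive.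
- by move=> n; exact: preimage_measurable.
- apply/trivIsetP => /= i j _ _ ij; rewrite -preimage_setI.
  by move/trivIsetP : tF => /(_ _ _ _ _ ij) ->//; rewrite preimage_set0.
- by rewrite -preimage_bigcup; exact: preimage_measurable.
Qed.

HB.instance Definition _ := isMeasure.Build _ _ _ pow_measure_step
  pow_measure_step0 pow_measure_step_ge0 pow_measure_step_sigma_additive.

Let pow_measure_step_sigma_finite : sigma_finite setT pow_measure_step.
Proof.
have /sigma_finiteP[F [TF ndF Foo]] := sigma_finiteT mu.
have /sigma_finiteP[G [TG ndG Goo]] := sigma_finiteT nu.
pose head_tail (t : k.+1.-tuple T) : T * k.-tuple T :=
  (thead t, [tuple of behead t]).
have mhead_tail : measurable_fun setT head_tail.
  apply/measurable_fun_pairP; split => /=; first exact: measurable_tnth.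
  exact: measurable_behead.
have tconsK p : head_tail (tcons p) = p.
  by case: p => x t; congr (_, _); exact/val_inj.
exists (fun i => head_tail @^-1` (F i `*` G i)).
  apply/seteqP; split => // t _.
  have [i _ Fi] : (\bigcup_i F i) (head_tail t).1 by rewrite -TF.
  have [j _ Gj] : (\bigcup_i G i) (head_tail t).2 by rewrite -TG.
  exists (maxn i j) => //; split.
  - by move: Fi; exact/subsetPset/ndF/leq_maxl.
  - by move: Gj; exact/subsetPset/ndG/leq_maxr.
move=> i; have [? ?] := Foo i; have [? ?] := Goo i; split.
  by rewrite -[X in measurable X]setTI; apply: mhead_tail => //; exact: measurableX.
rewrite /pow_measure_step /pushforward -comp_preimage.
rewrite (_ : head_tail \o @tcons k = id); last exact/funext.
by rewrite preimage_id product_measure1E// lte_mul_pinfty// ge0_fin_numE.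
Qed.

HB.instance Definition _ := Measure_isSigmaFinite.Build _ _ _
  pow_measure_step pow_measure_step_sigma_finite.
End step.

(* [pow_measure k] is the product measure of [k] copies of [mu]; see
   [pow_measureX]. *)
Fixpoint pow_measure k : {sigma_finite_measure set (k.-tuple T) -> \bar R} :=
  if k is k'.+1 return {sigma_finite_measure set (k.-tuple T) -> \bar R}
  then pow_measure_step (pow_measure k') else \d_([tuple] : 0.-tuple T).

Lemma pow_measureX k (A : 'I_k -> set T) : (forall i, measurable (A i)) ->
  pow_measure k [set t | forall i, A i (tnth t i)] = (\prod_(i < k) mu (A i))%E.
Proof.
elim: k A => [|k IHk] A mA.
  rewrite big_ord0 /= diracE mem_set// => -[].
  by [].
rewrite big_ord_recl -IHk; last by move=> i; exact: mA.
have mB : measurable [set t : k.-tuple T | forall i, A (lift ord0 i) (tnth t i)].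
  rewrite (_ : [set _ | _] = \bigcap_(i in [set: 'I_k])
      ((@tnth _ T ^~ i) @^-1` A (lift ord0 i))).
    apply: fin_bigcap_measurable => // i _.
    by rewrite -[X in measurable X]setTI; apply: measurable_tnth.
  by apply/seteqP; split => t /= At i; [move=> _|]; exact: At.
rewrite -product_measure1E//=.
congr (product_measure1 _ _ _); apply/seteqP; split => -[x t] /=.
  move=> At; split; first by have := At ord0; rewrite tnth0.
  by move=> i; have := At (lift ord0 i); rewrite tnthS.
move=> [Ax At] i; case: (unliftP ord0 i) => [j|] ->; last by rewrite tnth0.
by rewrite tnthS.
Qed.

End product_power.

(* Euler's integral; it represents Gamma for s > 0 only. *)
Definition Gamma (R : realType) (s : R) : R :=
  \int[lebesgue_measure]_(t in `]0, +oo[) (t `^ (s - 1) * expR (- t)).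

(* The underlying measurable space R^(2n+1) of the Heisenberg group. *)
Notation heisenberg R n := ((n.*2.+1).-tuple (measurableTypeR R)).

Section heisenberg.
Variables (R : realType) (n : nat).

Definition hmeasure : {sigma_finite_measure set (heisenberg R n) -> \bar R} :=
  pow_measure (@lebesgue_measure R) n.*2.+1.

(* The homogeneous dimension Q. *)
Definition hdim : nat := n.*2.+2.

Definition hcoord (x : heisenberg R n) (i : 'I_(n.*2.+1)) : R := tnth x i.

Definition hnorm (x : heisenberg R n) : R :=
  ((\sum_(i < n.*2) hcoord x (widen_ord (leqnSn _) i) ^+ 2) ^+ 2
   + hcoord x ord_max ^+ 2) `^ 4^-1.

Definition hball1 : set (heisenberg R n) := [set x | hnorm x < 1].

Definition Omega_Q : \bar R := hmeasure hball1.

Definition omega_Q : \bar R := (hdim%:R%:E * Omega_Q)%E.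

Definition radial (f : heisenberg R n -> R) : Prop :=
  forall x y, hnorm x = hnorm y -> f x = f y.

(* No finiteness is built in: the value is +oo when |f|^p w is not integrable. *)
Definition wLnorm (p : R) (w : heisenberg R n -> R)
    (f : heisenberg R n -> \bar R) : \bar R :=
  ((\int[hmeasure]_x (`|f x| `^ p * (w x)%:E)) `^ p^-1)%E.

(* At the origin, a null set, the value is the convention of powR and
   not a meaningful weight. *)
Definition hpower (a : R) (x : heisenberg R n) : R := hnorm x `^ a.

(* The m integrals over the group are one integral for the product measure.
   The operator is meant for x <> 0; its value at the origin is irrelevant to
   the norms. *)
Definition hilbert3 (m : nat) (f : 'I_m -> heisenberg R n -> R)
    (x : heisenberg R n) : \bar R :=
  (\int[pow_measure hmeasure m]_y
    ((\prod_(j < m) f j (tnth y j)) /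
     (hnorm x ^+ hdim + \sum_(j < m) hnorm (tnth y j) ^+ hdim) ^+ m)%R%:E)%E.

Definition radial_opnorm (m : nat)
    (T : ('I_m -> heisenberg R n -> R) -> heisenberg R n -> \bar R)
    (p : 'I_m -> R) (v : 'I_m -> heisenberg R n -> R)
    (q : R) (w : heisenberg R n -> R) : \bar R :=
  ereal_sup [set (wLnorm q w (T f) /
                  \prod_(j < m) wLnorm (p j) (v j) (EFin \o f j))%E
    | f in [set f : 'I_m -> heisenberg R n -> R | forall j,
        [/\ measurable_fun setT (f j), radial (f j) &
            (0 < wLnorm (p j) (v j) (EFin \o f j) < +oo)%E]]].

End heisenberg.

(* Main.v *)
(** Put rho(x) = |x|_h^Q. The scaling of the measure under dilations shows that
    integrating a function of rho over the group is Omega_Q times integrating it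
    over the half-line. Writing S^-m as the Laplace transform of
    s^(m-1) / Gamma(m) splits the kernel of the operator into a product of
    one-variable Laplace kernels exp(-s rho), so the operator is the composition
    of the Laplace transforms F_j of the f_j, a product, and another Laplace
    transform. Schur's test with power weights bounds each Laplace transform by
    a Gamma value, and Hoelder's inequality handles the product of the F_j; the
    resulting constant is the one claimed. It is attained in the limit along
    f_j = rho^(a_j - 1 - e/q_j) on rho > 1, with
    a_j = 1 - alpha_j/(qQ) - 1/q_j, when e tends to 0. *)
From HB Require Import structures.
Require Import Defs.
From mathcomp Require Import all_boot all_order all_algebra.
From mathcomp Require Import all_classical all_reals all_analysis.
From mathcomp Require Import measurable_realfun ring lra.

Set Implicit Arguments.
Unset Strict Implicit.
Unset Printing Implicit Defensive.

Import Order.TTheory GRing.Theory Num.Theory.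
Import numFieldNormedType.Exports.

Local Open Scope classical_set_scope.
Local Open Scope ring_scope.

(** Both Laplace transforms are bounded by one lemma, because the half-line is itself a gauge with
    constant 1: the first transform runs from the group to the half-line with exponent q_j and
    parameter a_j, the second back to the group with exponent q and parameter b = (alpha + Q) /
    (qQ). The hypotheses give a_j > 0, b > 0 and b + sum a_j = m; this last identity makes the
    weights of the two transforms match after Hoelder's inequality with exponents q_j / q. The
    powers of Omega_Q add up to q m, which leaves Omega_Q^m = omega_Q^m / Q^m after the q-th root.

    On the pure powers rho^(a_j - 1) every inequality used is formally an equality, but their norms
    are infinite, hence the perturbation by e and the cut at rho = 1. The cut spoils the Laplace
    transforms for large s. The lower bound therefore keeps only the part where s rho(x) and s
    rho(y_j) lie in [1/L, L]; rho(x) > L^2 then forces rho(y_j) > 1. The price is truncated Gamma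
    integrals and a factor L^(-4e/q), which tends to 1 with e for fixed L. *)

(** * Scaling, exhaustion and power integrals on the half-line *)

Section lebesgue_half_line.
Context {R : realType}.
Implicit Types (a b c s u v x : R) (f : R -> \bar R).

Local Notation leb := (@lebesgue_measure R).

Lemma ge0_integral_lebesgue_scale c (D : set R) f : 0 < c ->
  measurable D -> measurable_fun D f -> (forall x, D x -> (0 <= f x)%E) ->
  (\int[leb]_(x in *%R c @^-1` D) f (c * x)%R = c^-1%:E * \int[leb]_(x in D) f x)%E.
Proof.
move=> c0 mD mf f0.
have ci0 : 0 <= c^-1 by rewrite invr_ge0 ltW.
have mphi : measurable_fun [set: measurableTypeR R]
    ( *%R c : measurableTypeR R -> measurableTypeR R).
  exact: mulrl_measurable.
(* The canonical instance is named because [pushforward] alone does not carry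
   the measurability proof that makes it a measure. *)
pose nu : {measure set (measurableTypeR R) -> \bar R} :=
  measure_function_pushforward__canonical__measure_function_Measure leb mphi.
pose k := NngNum ci0.
have nuE A : measurable A -> nu A = mscale k leb A.
  pose ki := NngNum (ltW c0).
  move=> mA.
  (* Uniqueness characterizes Lebesgue measure by its values on half-open intervals, so c times the
     image measure is compared with [leb], and the relation is inverted afterwards. *)
  have : leb A = mscale ki nu A.
    apply: lebesgue_measure_unique => //= _ [[u v]] _ <-.
    have nuuv : nu `]u, v]%classic = leb `](u / c), (v / c)]%classic.
      congr leb; apply/seteqP; split => x /=;
      by rewrite !in_itv /= ltr_pdivrMr// ler_pdivlMr// (mulrC c).
    rewrite /mscale.
    rewrite [X in _ = (_ * X)%E]nuuv.
    rewrite [LHS]lebesgue_measure_itv [in RHS]lebesgue_measure_itv /= !lte_fin ltr_pM2r ?invr_gt0//.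
    case: ifPn => uv; last by rewrite mule0.
    by rewrite -!EFinB -EFinM; congr EFin; field; rewrite gt_eqF.
  rewrite /mscale /= => ->; rewrite muleA -EFinM mulVf ?mul1e//.
  by rewrite gt_eqF.
transitivity (\int[nu]_(x in D) f x)%E.
  rewrite [RHS](ge0_integral_pushforward mphi)// => y /[!inE]; exact: f0.
rewrite (eq_measure_integral (mscale k leb)); last by move=> A mA _; exact: nuE.
by rewrite ge0_integral_mscale.
Qed.

Lemma ge0_integral_scale0y c f : 0 < c ->
  measurable_fun setT f -> (forall x, (0 <= f x)%E) ->
  (\int[leb]_(x in `]0%R, +oo[) f (c * x)%R =
   c^-1%:E * \int[leb]_(x in `]0%R, +oo[) f x)%E.
Proof.
move=> c0 mf f0; rewrite -ge0_integral_lebesgue_scale//; last exact: measurable_funTS.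
congr integral; apply/seteqP; split => x /=;
  by rewrite !in_itv /= !andbT pmulr_rgt0.
Qed.

(** Compact intervals inside the open half-line, where all real powers are continuous. The shift by
    one keeps the left end meaningful at k = 0. *)
Definition window (k : nat) : set R := `[k.+1%:R^-1, k.+1%:R]%classic.

Lemma window_bigcup : \bigcup_k window k = `]0, +oo[%classic.
Proof.
apply/seteqP; split => x /=.
  move=> [k _]; rewrite /window/= !in_itv /= andbT => /andP[+ _].
  by apply: lt_le_trans; rewrite invr_gt0.
rewrite in_itv /= andbT => x0.
exists (maxn (Num.truncn x) (Num.truncn x^-1)) => //.
rewrite /window/= in_itv /=; apply/andP; split.
  rewrite invf_ple ?posrE//; apply: (le_trans (ltW (truncnS_gt _))).
  by rewrite ler_nat ltnS leq_maxr.
by apply: (le_trans (ltW (truncnS_gt _))); rewrite ler_nat ltnS leq_maxl.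
Qed.

Lemma window_nondecreasing : {homo window : n m / (n <= m)%N >-> (n <= m)%O}.
Proof.
move=> k l kl; apply/subsetPset => x; rewrite /window/= !in_itv/= => /andP[kx xk].
apply/andP; split; last by rewrite (le_trans xk)// ler_nat ltnS.
by apply: le_trans kx; rewrite lef_pV2 ?posrE// ler_nat ltnS.
Qed.

Lemma cvg_integral_window f : measurable_fun setT f -> (forall x, (0 <= f x)%E) ->
  ((\int[leb]_(x in window k) f x)%E @[k --> \oo] -->
   \int[leb]_(x in `]0%R, +oo[) f x)%E.
Proof.
move=> mf f0; rewrite -window_bigcup; apply: ge0_nondecreasing_set_cvg_integral => //.
- exact: window_nondecreasing.
- by move=> i; exact: measurable_itv.
- by move=> i; exact: measurable_funTS.
Qed.

Lemma le_integral_window f (C : \bar R) : measurable_fun setT f -> (forall x, (0 <= f x)%E) ->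
  (forall k, \int[leb]_(x in window k) f x <= C)%E ->
  (\int[leb]_(x in `]0%R, +oo[) f x <= C)%E.
Proof.
move=> mf f0 fC; have := cvg_integral_window mf f0.
move=> /cvg_lim => <-//; apply: lime_le; last exact: nearW.
by apply/cvg_ex; eexists; exact: cvg_integral_window.
Qed.

Lemma integral_powR u v c : 0 < u -> u <= v -> c != 0 ->
  (\int[leb]_(x in `[u, v]) (x `^ (c - 1))%:E = ((v `^ c - u `^ c) / c)%:E)%E.
Proof.
move=> u0; rewrite le_eqVlt => /predU1P[<- _|uv c0].
  by rewrite subrr mul0r set_itv1 integral_set1.
have gt0 (x : R) : u <= x -> 0 < x by exact: lt_le_trans.
have der (x : R) : 0 < x -> is_derive x 1 (c^-1 *: (@powR R ^~ c : R -> R^o)) (x `^ (c - 1)).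
  move=> x0; have := is_deriveZ c^-1 (@is_derive1_powR R c x x0).
  by rewrite /GRing.scale/= mulrA mulVf// mul1r.
have cont (x : R) : 0 < x -> {for x, continuous (c^-1 *: (@powR R ^~ c : R -> R^o))}.
  by move=> x0; apply/differentiable_continuous/derivable1_diffP; have [] := der x x0.
have cf (x : R) : 0 < x -> {for x, continuous (@powR R ^~ (c - 1) : R -> R^o)}.
  by move=> x0; apply/differentiable_continuous/derivable1_diffP; have [] := @is_derive1_powR R (c - 1) x x0.
rewrite (@continuous_FTC2 _ _ (c^-1 *: (@powR R ^~ c : R -> R^o)) _ _ uv).
- rewrite /= -EFinB; congr EFin; rewrite /GRing.scale/=.
  by rewrite mulrBl !(mulrC _ c^-1).
- apply: continuous_in_subspaceT => x; rewrite inE/= in_itv/= => /andP[ux _].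
  by apply: cf; exact: gt0.
- split.
  + by move=> x; rewrite in_itv/= => /andP[ux _]; have [] := der x (gt0 _ (ltW ux)).
  + by apply: cvg_at_right_filter; apply: cont; exact: gt0.
  + by apply: cvg_at_left_filter; apply: cont; apply: gt0; exact: ltW.
- move=> x; rewrite in_itv/= => /andP[ux _].
  by rewrite derive1E; have [_ ->] := der x (gt0 _ (ltW ux)).
Qed.

End lebesgue_half_line.

(** * The Gamma integral and the tails of powers *)

Section gamma_integral.
Context {R : realType}.
Implicit Types (a b c e s u v x M : R) (f : R -> \bar R).
Local Notation leb := (@lebesgue_measure R).

(** With y = x s / a the claim is y^a <= exp(a y), which is ln y <= y. The true maximum, at x = a /
    s, has a further factor exp(-a), which is given up. *)
Lemma powR_expRN_le a s x : 0 < a -> 0 < s -> 0 <= x ->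
  x `^ a * expR (- (s * x)) <= (a / s) `^ a.
Proof.
move=> a0 s0; rewrite le_eqVlt => /predU1P[<-|x0].
  by rewrite powR0 ?gt_eqF// mul0r powR_ge0.
have y0 : 0 < x * s / a by rewrite divr_gt0// mulr_gt0.
have -> : x `^ a = (a / s) `^ a * (x * s / a) `^ a.
  rewrite -powRM ?(ltW y0) ?divr_ge0 ?ltW//.
  by congr powR; field; rewrite !gt_eqF.
rewrite -(mulrA (powR _ _)) ler_piMr ?powR_ge0//.
rewrite /powR (gt_eqF y0) -expRD -[leRHS]expR0 ler_expR.
have -> : - (s * x) = - (a * (x * s / a)) by field; rewrite gt_eqF.
by rewrite -mulrBr mulr_ge0_le0 ?subr_le0 ?ltW// ln_sublinear.
Qed.

Lemma measurable_gamma_integrand a c :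
  measurable_fun setT (fun x : R => x `^ (a - 1) * expR (- (c * x))).
Proof.
apply: measurable_funM; first exact: measurable_powR.
by apply: measurableT_comp => //; apply: measurableT_comp.
Qed.

Let measurable_integrand_EFin a c :
  measurable_fun setT (fun x : R => (x `^ (a - 1) * expR (- (c * x)))%:E).
Proof. by apply/measurable_EFinP; exact: measurable_gamma_integrand. Qed.

Let integrand_ge0 a c x : (0 <= (x `^ (a - 1) * expR (- (c * x)))%:E)%E.
Proof. by rewrite lee_fin mulr_ge0 ?powR_ge0 ?expR_ge0. Qed.

Let measurable_powR_EFin a : measurable_fun setT (fun x : R => (x `^ a)%:E).
Proof. by apply/measurable_EFinP; exact: measurable_powR. Qed.

Lemma gamma_integral_lty a : 0 < a ->
  (\int[leb]_(x in `]0%R, +oo[) (x `^ (a - 1) * expR (- (1 * x)))%:E < +oo)%E.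
Proof.
(* The term 1 / a bounds the integral of x^(a-1) up to 1. Beyond 1 the integrand is at most
   (a+1)^(a+1) x^(-2) by [powR_expRN_le], and x^(-2) has integral at most 1 there. *)
move=> a0; apply: (@le_lt_trans _ _ ((1 / a) + ((a + 1) / 1) `^ (a + 1))%:E); last exact: ltry.
apply: le_integral_window; [exact: measurable_integrand_EFin|by move=> x; exact: integrand_ge0|].
move=> k; rewrite /window.
have k1 : (k.+1%:R^-1 : R) <= 1 by rewrite invf_le1// ler1n.
have k2 : 1 <= (k.+1%:R : R) by rewrite ler1n.
rewrite (@itv_bndbnd_setU _ _ _ (BLeft 1)) ?bnd_simp//.
rewrite ge0_integral_setU//=; last 2 first.
- by apply: measurable_funTS; exact: measurable_integrand_EFin.
- rewrite disj_set2E; apply/eqP/seteqP; split => x //=.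
  rewrite /= !in_itv/= => -[/andP[_ x1] /andP[]].
  by rewrite leNgt x1.
rewrite EFinD leeD//.
- apply: (@le_trans _ _ (\int[leb]_(x in `[k.+1%:R^-1%R, 1%R]) (x `^ (a - 1))%:E)%E).
    apply: (@le_trans _ _ (\int[leb]_(x in `[k.+1%:R^-1%R, 1%R]) (x `^ (a - 1) * expR (- (1 * x)))%:E)%E).
      apply: ge0_subset_integral => //.
      - by apply: measurable_funTS; exact: measurable_integrand_EFin.
      - by move=> x /=; rewrite !in_itv/= => /andP[-> /ltW ->].
    apply: ge0_le_integral => //.
    - by apply: measurable_funTS; exact: measurable_integrand_EFin.
    - by apply: measurable_funTS; exact: measurable_powR_EFin.
    - move=> x /=; rewrite in_itv/= => /andP[kx _].
      rewrite lee_fin ler_piMr ?powR_ge0// -[leRHS]expR0 ler_expR mul1r oppr_le0.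
      by apply: le_trans kx; rewrite invr_ge0.
  rewrite integral_powR// ?invr_gt0 ?(gt_eqF a0)// lee_fin powR1.
  by rewrite ler_pM2r ?invr_gt0// lerBlDr lerDl powR_ge0.
- apply: (@le_trans _ _ (\int[leb]_(x in `[1%R, k.+1%:R]) (((a + 1) / 1) `^ (a + 1) * x `^ (- 1 - 1))%:E)%E).
    apply: ge0_le_integral => //.
    - by apply: measurable_funTS; exact: measurable_integrand_EFin.
    - by apply: measurable_funTS; apply/measurable_EFinP; apply: measurable_funM => //; exact: measurable_powR.
    - move=> x /=; rewrite in_itv/= => /andP[x1 _].
      have x0 : 0 < x by exact: lt_le_trans x1.
      rewrite lee_fin (_ : a - 1 = (a + 1) + (- 1 - 1)); last by ring.
      rewrite powRD; last by rewrite (gt_eqF x0) implybT.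
      rewrite mulrAC ler_wpM2r ?powR_ge0//.
      by apply: powR_expRN_le; rewrite // ?addr_gt0// ltW.
  under eq_integral do rewrite EFinM.
  rewrite ge0_integralZl_EFin ?powR_ge0//; last first.
  - by apply: measurable_funTS; exact: measurable_powR_EFin.
  - by move=> x _; rewrite lee_fin powR_ge0.
  rewrite integral_powR ?oppr_eq0// -EFinM lee_fin powR1.
  rewrite ler_piMr ?powR_ge0// invrN invr1 mulrN1 opprB lerBlDr lerDl powR_ge0//.
Qed.

(** [Gamma] is only the real part of an extended integral, so finiteness is what identifies the two;
    the power of c comes from substituting c x. *)
Lemma gamma_integralE a c : 0 < a -> 0 < c ->
  (\int[leb]_(x in `]0%R, +oo[) (x `^ (a - 1) * expR (- (c * x)))%:E =
   (c `^ (- a) * Gamma a)%:E)%E.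
Proof.
move=> a0 c0.
have Ga : (Gamma a)%:E = (\int[leb]_(x in `]0%R, +oo[) (x `^ (a - 1) * expR (- (1 * x)))%:E)%E.
  rewrite /Gamma /Rintegral.
  under [in RHS]eq_integral do rewrite mul1r.
  rewrite fineK// ge0_fin_numE; last first.
    by apply: integral_ge0 => x _; rewrite lee_fin mulr_ge0 ?powR_ge0 ?expR_ge0.
  apply: le_lt_trans (gamma_integral_lty a0).
  by rewrite le_eqVlt; apply/orP; left; apply/eqP; apply: eq_integral => x _; rewrite mul1r.
rewrite EFinM Ga (_ : c `^ (- a) = c `^ (1 - a) / c); last first.
  rewrite powRD; last by rewrite (gt_eqF c0) implybT.
  by rewrite powRr1 ?ltW// mulrAC divff ?mul1r// gt_eqF.
rewrite EFinM -muleA -ge0_integral_scale0y//.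
rewrite -ge0_integralZl_EFin ?powR_ge0//; last first.
- apply/measurable_EFinP; apply: measurable_funTS.
  have := measurableT_comp (measurable_gamma_integrand a 1) (mulrl_measurable c).
  exact.
apply: eq_integral => x; rewrite inE/= in_itv/= andbT => x0.
rewrite -EFinM mul1r powRM ?ltW// !mulrA -powRD; last by rewrite (gt_eqF c0) implybT.
by rewrite (_ : 1 - a + (a - 1) = 0) ?powRr0 ?mul1r//; ring.
Qed.

Lemma Gamma_gt0 a : 0 < a -> 0 < Gamma a.
Proof.
move=> a0; rewrite -lte_fin.
have -> : (Gamma a)%:E = (\int[leb]_(x in `]0%R, +oo[) (x `^ (a - 1) * expR (- (1 * x)))%:E)%E.
  by rewrite gamma_integralE// powR1 mul1r.
(* A lower bound of the integrand on [1, 2]; the minimum covers both signs of a - 1. *)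
pose m := Num.min 1 (2 `^ (a - 1)) * expR (- 2).
have m0 : 0 < m by rewrite mulr_gt0 ?expR_gt0// lt_min ltr01 powR_gt0.
apply: (@lt_le_trans _ _ (\int[leb]_(x in `[1%R, 2%R]) m%:E)%E).
  rewrite integral_cst// [X in (_ * X)%E]lebesgue_measure_itv/= lte_fin ltr1n/=.
  by rewrite -EFinB -EFinM lte_fin mulr_gt0// subr_gt0 ltr1n.
apply: (@le_trans _ _ (\int[leb]_(x in `[1%R, 2%R]) (x `^ (a - 1) * expR (- (1 * x)))%:E)%E).
  apply: ge0_le_integral => //.
  - by move=> x _; rewrite lee_fin ltW.
  - by apply: measurable_funTS; exact: measurable_integrand_EFin.
  move=> x /=; rewrite in_itv/= => /andP[x1 x2].
  have x0 : 0 < x by exact: lt_le_trans x1.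
  rewrite lee_fin ler_pM ?expR_ge0//.
    have [a1|a1] := leP 0 (a - 1).
      rewrite ge_min; apply/orP; left.
      have : 1 `^ (a - 1) <= x `^ (a - 1) by rewrite ge0_ler_powR ?nnegrE// ltW.
      by rewrite powR1.
    rewrite ge_min; apply/orP; right.
    rewrite -(opprK (a - 1)) powRN [leRHS]powRN lef_pV2 ?posrE ?powR_gt0//.
    by rewrite ge0_ler_powR ?nnegrE// ?ltW// oppr_gt0.
  by rewrite ler_expR mul1r lerN2.
apply: ge0_subset_integral => //; first by apply: measurable_funTS; exact: measurable_integrand_EFin.
by move=> x /=; rewrite !in_itv/= andbT => /andP[+ _]; exact: lt_le_trans.
Qed.

(** The dependence on M comes from the substitution x / M. The constant K, which is 1 / e, is left
    abstract because it cancels between the norm of the image and the norms of the test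
    functions. *)
Lemma integral_powR_tail e : 0 < e -> exists2 K : R, 0 < K &
  forall M, 0 < M ->
    (\int[leb]_(x in `]M, +oo[) (x `^ (- e - 1))%:E = (M `^ (- e) * K)%:E)%E.
Proof.
move=> e0; pose I := (\int[leb]_(x in `]1%R, +oo[) (x `^ (- e - 1))%:E)%E.
have e0' : - e != 0 by rewrite oppr_eq0 gt_eqF.
have Ige0 : (0 <= I)%E by apply: integral_ge0 => x _; rewrite lee_fin powR_ge0.
have Ilty : (I <= e^-1%:E)%E.
  rewrite /I; pose f := (fun x : R => (x `^ (- e - 1))%:E) \_ `]1%R, +oo[.
  have -> : (\int[leb]_(x in `]1%R, +oo[) (x `^ (- e - 1))%:E = \int[leb]_(x in `]0%R, +oo[) f x)%E.
    rewrite integral_mkcond [RHS]integral_mkcond; apply: eq_integral => x _.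
    rewrite /f !patchE; case: ifPn => x1; last by case: ifP.
    rewrite ifT//; move: x1; rewrite !inE/= !in_itv/= !andbT.
    exact: lt_trans.
  have f0 x : (0 <= f x)%E by rewrite /f patchE; case: ifPn => // _; rewrite lee_fin powR_ge0.
  have mf : measurable_fun setT f.
    by apply/(measurable_restrictT _ _).1 => //; apply: measurable_funTS; exact: measurable_powR_EFin.
  apply: le_integral_window => // k.
  have k2 : 1 <= (k.+1%:R : R) by rewrite ler1n.
  apply: (@le_trans _ _ (\int[leb]_(x in `[1%R, k.+1%:R]) (x `^ (- e - 1))%:E)%E).
    rewrite integral_mkcond [leRHS]integral_mkcond.
    apply: ge0_le_integral => //.
    - by move=> x _; rewrite patchE; case: ifPn.
    - by apply/(measurable_restrictT _ _).1; [exact: measurable_itv|exact: measurable_funTS].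
    - by apply/(measurable_restrictT _ _).1; [exact: measurable_itv|apply: measurable_funTS; exact: measurable_powR_EFin].
    move=> x _; rewrite /f !patchE; case: ifPn => [|_]; last first.
      by case: ifPn => // _; rewrite lee_fin powR_ge0.
    case: ifPn => [|_ _]; last by case: ifPn => // _; rewrite lee_fin powR_ge0.
    rewrite !inE/= /window/= !in_itv/= andbT => x1 /andP[_ xk].
    by rewrite ifT// inE/= in_itv/= xk ltW.
  rewrite integral_powR// lee_fin powR1 invrN mulrN -mulNr opprB ler_piMl ?invr_ge0 ?ltW//.
have Igt0 : (0 < I)%E.
  apply: (@lt_le_trans _ _ (\int[leb]_(x in `[2%R, 3%R]) (x `^ (- e - 1))%:E)%E).
    rewrite integral_powR// ?ler_nat// lte_fin invrN mulrN -mulNr opprB mulr_gt0 ?invr_gt0//.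
    rewrite subr_gt0 !powRN ltf_pV2 ?posrE ?powR_gt0//.
    by rewrite gt0_ltr_powR ?nnegrE// ltr_nat.
  apply: ge0_subset_integral => //; first by apply: measurable_funTS; exact: measurable_powR_EFin.
    by move=> x _; rewrite lee_fin powR_ge0.
  move=> x /=; rewrite !in_itv/= andbT => /andP[+ _]; apply: lt_le_trans.
  by rewrite ltr1n.
have Ifin : I \is a fin_num by rewrite ge0_fin_numE// (le_lt_trans Ilty)// ltry.
exists (fine I); first by rewrite fine_gt0// Igt0 -ge0_fin_numE.
move=> M M0; rewrite EFinM fineK//.
have Mi : 0 < M^-1 by rewrite invr_gt0.
have -> : `]M, +oo[%classic = *%R M^-1 @^-1` `]1%R, +oo[%classic.
  apply/seteqP; split => x /=; rewrite !in_itv/= !andbT mulrC;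
  by rewrite ltr_pdivlMr// mul1r.
rewrite (_ : M `^ (- e) = M `^ (- e - 1) * M); last first.
  by rewrite -[X in _ * X]powRr1 ?ltW// -powRD ?subrK// (gt_eqF M0) implybT.
rewrite EFinM -muleA -[X in (X%:E * I)%E]invrK -ge0_integral_lebesgue_scale//; last first.
- by move=> x _; rewrite lee_fin powR_ge0.
- by apply: measurable_funTS; exact: measurable_powR_EFin.
rewrite -ge0_integralZl_EFin ?powR_ge0//; last 3 first.
- rewrite -[X in measurable X]setTI; exact: mulrl_measurable.
- by move=> x _; rewrite lee_fin powR_ge0.
- apply: measurable_funTS.
  exact: (measurableT_comp (measurable_powR_EFin _) (mulrl_measurable _)).
apply: eq_integral => x; rewrite inE/= in_itv/= andbT => x1.
rewrite -EFinM -powRM ?ltW//; last exact: lt_trans x1.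
by rewrite mulVKf// gt_eqF.
Qed.

End gamma_integral.

(** * Hoelder's inequality, weighted and for several factors *)

Section integral_inequalities.
Context d (T : measurableType d) (R : realType).
Variable mu : {measure set T -> \bar R}.

Lemma measurable_bigprod (I : Type) (s : seq I) (F : I -> T -> R) :
  (forall i, measurable_fun setT (F i)) ->
  measurable_fun setT (fun x => \prod_(i <- s) F i x).
Proof.
move=> mF; elim: s => [|i s IH].
  by under eq_fun do rewrite big_nil; exact: measurable_cst.
by under eq_fun do rewrite big_cons; exact: measurable_funM.
Qed.

Lemma measurable_bigsum (I : Type) (s : seq I) (F : I -> T -> R) :
  (forall i, measurable_fun setT (F i)) ->
  measurable_fun setT (fun x => \sum_(i <- s) F i x).
Proof.
move=> mF; elim: s => [|i s IH].
  by under eq_fun do rewrite big_nil; exact: measurable_cst.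
by under eq_fun do rewrite big_cons; exact: measurable_funD.
Qed.

Lemma measurable_powR_comp (f : T -> R) a :
  measurable_fun setT f -> measurable_fun setT (fun x => f x `^ a).
Proof. by move=> mf; exact: measurableT_comp (measurable_powR a) mf. Qed.

(* Hoelder's inequality for h w^(1/p) and w^(1-1/p). *)
Lemma ge0_integral_powR_le (D : set T) (h w : T -> R) p : 1 < p ->
  measurable D -> measurable_fun setT h -> measurable_fun setT w ->
  (forall x, D x -> 0 <= h x) -> (forall x, D x -> 0 <= w x) ->
  ((\int[mu]_(x in D) (h x * w x)%:E) `^ p <=
   (\int[mu]_(x in D) (w x)%:E) `^ (p - 1) *
   \int[mu]_(x in D) (h x `^ p * w x)%:E)%E.
Proof.
move=> p1 mD mh mw h0 w0.
have p0 : 0 < p by exact: lt_trans p1.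
have pn0 : p != 0 by rewrite gt_eqF.
have pm1 : p - 1 != 0 by rewrite subr_eq0 gt_eqF.
have q0 : 0 < p / (p - 1) by rewrite divr_gt0// subr_gt0.
have pq : p^-1 + (p / (p - 1))^-1 = 1.
  by field; rewrite ?pn0 ?pm1.
(* The indicators reduce the claim to Hoelder's inequality on the whole space; the signs of h and w
   are known on [D] only. *)
pose f x := (h x * w x `^ p^-1) * \1_D x.
pose g x := (w x `^ (p / (p - 1))^-1) * \1_D x.
have mf : measurable_fun setT f.
  by apply: measurable_funM => //; apply: measurable_funM => //; exact: measurable_powR_comp.
have mg : measurable_fun setT g.
  by apply: measurable_funM => //; exact: measurable_powR_comp.
have := hoelder mu mf mg p0 q0 pq.
rewrite Lnorm1 unlock.
have -> : (\int[mu]_x `|(EFin \o (f \* g)%R) x| = \int[mu]_(x in D) (h x * w x)%:E)%E.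
  rewrite [RHS]integral_mkcond; apply: eq_integral => x _.
  rewrite /= /f /g patchE indicE; case: ifPn => xD; last by rewrite !mulr0 normr0.
  move: xD; rewrite inE => Dx; rewrite !mulr1 -mulrA -powRD ?pq ?oner_eq0//.
  by rewrite powRr1 ?w0// ger0_norm// mulr_ge0 ?h0 ?w0.
have -> : (\int[mu]_x `|(EFin \o f) x| `^ p = \int[mu]_(x in D) (h x `^ p * w x)%:E)%E.
  rewrite [RHS]integral_mkcond; apply: eq_integral => x _.
  rewrite /= /f patchE indicE; case: ifPn => xD; last by rewrite !mulr0 normr0 powR0 ?gt_eqF.
  move: xD; rewrite inE => Dx; rewrite !mulr1 ger0_norm ?mulr_ge0 ?h0 ?powR_ge0//.
  by rewrite powRM ?powR_ge0 ?h0// -powRrM mulVf ?gt_eqF// powRr1 ?w0.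
have -> : (\int[mu]_x `|(EFin \o g) x| `^ (p / (p - 1)) = \int[mu]_(x in D) (w x)%:E)%E.
  rewrite [RHS]integral_mkcond; apply: eq_integral => x _.
  rewrite /= /g patchE indicE; case: ifPn => xD; last by rewrite !mulr0 normr0 powR0 ?gt_eqF.
  move: xD; rewrite inE => Dx; rewrite !mulr1 ger0_norm ?powR_ge0//.
  by rewrite -powRrM mulVf ?gt_eqF// powRr1 ?w0.
have I0 : (0 <= \int[mu]_(x in D) (h x * w x)%:E)%E.
  by apply: integral_ge0 => x Dx; rewrite lee_fin mulr_ge0 ?h0 ?w0.
move=> H.
have := gt0_ler_poweR (ltW p0) _ _ H; rewrite !in_itv/= !leey !andbT.
rewrite I0 mule_ge0 ?poweR_ge0// => /(_ isT isT); move/le_trans; apply.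
rewrite poweRM ?poweR_ge0// -!poweRrM mulVf ?gt_eqF// poweRe1; last first.
  by apply: integral_ge0 => x Dx; rewrite lee_fin mulr_ge0 ?powR_ge0 ?w0.
rewrite muleC (_ : (p / (p - 1))^-1 * p = p - 1)//.
by field; rewrite ?pn0 ?pm1.
Qed.

(** Let A be the weighted mean. The tangent inequality ln t <= t - 1 at t = x_j / A, summed with the
    weights theta_j, has right-hand side 0. If some x_j vanishes, so does the product, since theta_j
    > 0. *)
Lemma weighted_AGM (m : nat) (theta x : 'I_m -> R) :
  (forall j, 0 < theta j) -> \sum_(j < m) theta j = 1 ->
  (forall j, 0 <= x j) ->
  \prod_(j < m) x j `^ theta j <= \sum_(j < m) theta j * x j.
Proof.
move=> t0 t1 x0.
have [/forallP xp|/forallPn[j]] := boolP [forall j, 0 < x j]; last first.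
  rewrite -leNgt => xj; have xj0 : x j = 0 by apply/eqP; rewrite eq_le xj x0.
  rewrite (bigD1 j)//= xj0 powR0 ?gt_eqF// mul0r.
  by apply: sumr_ge0 => i _; rewrite mulr_ge0// ltW.
set A := \sum_(j < m) theta j * x j.
have A0 : 0 < A.
  have m0 : (0 < m)%N.
    rewrite lt0n; apply/eqP => m0; move: t1; subst m; rewrite big_ord0 => /eqP.
    by rewrite eq_sym oner_eq0.
  rewrite /A (bigD1 (Ordinal m0))//= ltr_pwDl ?mulr_gt0//.
  by apply: sumr_ge0 => i _; rewrite mulr_ge0// ltW.
have -> : \prod_(j < m) x j `^ theta j = expR (\sum_(j < m) theta j * ln (x j)).
  by rewrite expR_sum; apply: eq_bigr => j _; rewrite /powR gt_eqF.
rewrite -[leRHS]lnK ?posrE// ler_expR -[ln A]mul1r -t1 mulr_suml -subr_ge0 -sumrB.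
apply: (@le_trans _ _ (\sum_(j < m) theta j * (1 - x j / A))).
  under eq_bigr do rewrite mulrBr mulr1 mulrA.
  by rewrite sumrB t1 -mulr_suml divff ?subrr// gt_eqF.
apply: ler_sum => j _; rewrite -mulrBr ler_wpM2l ?(ltW (t0 j))//.
rewrite -opprB lerNl opprB -ln_div ?posrE//.
have := @le_ln1Dx R (x j / A - 1); rewrite subrKC; apply.
by rewrite ltrBDr addNr divr_gt0.
Qed.

(** Hoelder's inequality for m factors: [weighted_AGM] is applied pointwise to g_j / c_j, and the
    integrated sum is at most the sum of the theta_j. Positive bounds c_j stand in for the integrals
    themselves so that this division is legitimate even if an integral vanishes. *)
Lemma ge0_integral_prod_powR_le (m : nat) (D : set T) (g : 'I_m -> T -> R)
    (theta c : 'I_m -> R) :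
  measurable D -> (forall j, measurable_fun setT (g j)) ->
  (forall j x, D x -> 0 <= g j x) ->
  (forall j, 0 < theta j) -> \sum_(j < m) theta j = 1 ->
  (forall j, 0 < c j) -> (forall j, \int[mu]_(x in D) (g j x)%:E <= (c j)%:E)%E ->
  (\int[mu]_(x in D) (\prod_(j < m) g j x `^ theta j)%:E <=
   (\prod_(j < m) c j `^ theta j)%:E)%E.
Proof.
move=> mD mg g0 t0 t1 c0 gc.
pose C := \prod_(j < m) c j `^ theta j.
have C0 : 0 <= C by apply: prodr_ge0 => j _; exact: powR_ge0.
apply: (@le_trans _ _ (\int[mu]_(x in D) (C%:E * \sum_(j < m) (theta j / c j)%:E * (g j x)%:E))%E).
  apply: ge0_le_integral => //.
  - by move=> x Dx; rewrite lee_fin; apply: prodr_ge0 => j _; exact: powR_ge0.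
  - apply/measurable_EFinP; apply: measurable_funTS; apply: measurable_bigprod => j.
    exact: measurable_powR_comp.
  - apply: emeasurable_funM => //; apply: measurable_funTS.
    apply: emeasurable_sum => j _; apply: emeasurable_funM => //.
    exact/measurable_EFinP.
  move=> x Dx.
  under [X in (_ <= _ * X)%E]eq_bigr do rewrite -EFinM.
  rewrite sumEFin -EFinM lee_fin.
  have -> : \prod_(j < m) g j x `^ theta j = C * \prod_(j < m) (g j x / c j) `^ theta j.
    rewrite -big_split/=; apply: eq_bigr => j _.
    rewrite -powRM ?(ltW (c0 j)) ?divr_ge0 ?g0 ?(ltW (c0 j))//.
    by rewrite mulrCA divff ?mulr1// gt_eqF.
  rewrite ler_wpM2l//; under [leRHS]eq_bigr do rewrite -mulrA (mulrC _^-1).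
  by apply: weighted_AGM => // j; rewrite divr_ge0 ?g0// ltW.
have s0 j : 0 <= theta j / c j by rewrite divr_ge0 ?ltW.
rewrite ge0_integralZl_EFin//; last 2 first.
- by move=> x Dx; apply: sume_ge0 => j _; rewrite mule_ge0 ?lee_fin ?g0.
- apply: measurable_funTS; apply: emeasurable_sum => j _; apply: emeasurable_funM => //.
  exact/measurable_EFinP.
rewrite ge0_integral_sum//; last 2 first.
- by move=> j; apply: measurable_funTS; apply: emeasurable_funM => //; exact/measurable_EFinP.
- by move=> j x Dx; rewrite mule_ge0 ?lee_fin ?g0.
rewrite -[leRHS]mule1; apply: lee_wpmul2l; first by rewrite lee_fin.
apply: (@le_trans _ _ (\sum_(j < m) (theta j)%:E)%E); last by rewrite sumEFin t1.
apply: lee_sum => j _; rewrite ge0_integralZl_EFin//; last 2 first.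
- by move=> x Dx; rewrite lee_fin g0.
- by apply: measurable_funTS; exact/measurable_EFinP.
apply: (@le_trans _ _ ((theta j / c j)%:E * (c j)%:E)%E).
  by apply: lee_wpmul2l; rewrite ?lee_fin.
by rewrite -EFinM divfK// gt_eqF.
Qed.

End integral_inequalities.

(** * Tonelli's theorem on measurable subsets *)

Section fubini_in.
Context d1 d2 (T1 : measurableType d1) (T2 : measurableType d2) (R : realType).
Variables (m1 : {sigma_finite_measure set T1 -> \bar R})
  (m2 : {sigma_finite_measure set T2 -> \bar R}).

Lemma fubini_tonelli_in (D1 : set T1) (D2 : set T2) (f : T1 * T2 -> \bar R) :
  measurable D1 -> measurable D2 -> measurable_fun setT f ->
  (forall z, (0 <= f z)%E) ->
  (\int[m1]_(x in D1) \int[m2]_(y in D2) f (x, y) =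
   \int[m2]_(y in D2) \int[m1]_(x in D1) f (x, y))%E.
Proof.
move=> mD1 mD2 mf f0.
pose g := f \_ (D1 `*` D2).
have mg : measurable_fun setT g.
  by apply/(measurable_restrictT _ _).1; [exact: measurableX|exact: measurable_funTS].
have g0 z : (0 <= g z)%E by rewrite /g patchE; case: ifP.
have := @fubini_tonelli _ _ _ _ _ m1 m2 g mg g0.
have -> : (\int[m1]_x \int[m2]_y g (x, y) = \int[m1]_(x in D1) \int[m2]_(y in D2) f (x, y))%E.
  rewrite [RHS]integral_mkcond; apply: eq_integral => x _.
  rewrite patchE; case: ifPn => xD1.
    rewrite [RHS]integral_mkcond; apply: eq_integral => y _.
    rewrite /g !patchE; congr (if _ then _ else _).
    apply/idP/idP; rewrite !inE => H; first by case: H.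
    by split => //; move: xD1; rewrite inE.
  rewrite integral0_eq// => y _; rewrite /g patchE ifF//.
  by apply/negbTE; apply: contra xD1; rewrite !inE => -[].
move=> ->.
rewrite [RHS]integral_mkcond; apply: eq_integral => y _.
rewrite patchE; case: ifPn => yD2.
  rewrite [RHS]integral_mkcond; apply: eq_integral => x _.
  rewrite /g !patchE; congr (if _ then _ else _).
  apply/idP/idP; rewrite !inE => H; first by case: H.
  by split => //; move: yD2; rewrite inE.
rewrite integral0_eq// => x _; rewrite /g patchE ifF//.
by apply/negbTE; apply: contra yD2; rewrite !inE => -[].
Qed.

Lemma measurable_fun_integral_in (D2 : set T2) (f : T1 * T2 -> \bar R) :
  measurable D2 -> measurable_fun setT f -> (forall z, (0 <= f z)%E) ->
  measurable_fun setT (fun x => \int[m2]_(y in D2) f (x, y))%E.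
Proof.
move=> mD2 mf f0; under eq_fun do rewrite integral_mkcond.
pose g := f \_ (setT `*` D2).
have -> : (fun x => \int[m2]_y ((fun y => f (x, y)) \_ D2) y)%E = (fun x => \int[m2]_y g (x, y))%E.
  apply/funext => x; apply: eq_integral => y _; rewrite /g !patchE.
  by congr (if _ then _ else _); apply/idP/idP; rewrite !inE => // -[].
apply: measurable_fun_fubini_tonelli_F.
  by apply/(measurable_restrictT _ _).1; [exact: measurableX|exact: measurable_funTS].
by move=> z; rewrite /g patchE; case: ifP.
Qed.

End fubini_in.

(* [rho] plays the role of |x|_h^Q and [O] that of Omega_Q: integrating a
   function of [rho] is integrating over the half-line with density [O]. *)
Definition gauge d (T : measurableType d) (R : realType)
    (mu : {measure set T -> \bar R}) (rho : T -> R) (O : R) : Prop :=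
  [/\ measurable_fun setT rho, 0 < O &
      forall g : R -> \bar R, measurable_fun setT g -> (forall r, 0 <= g r)%E ->
        (\int[mu]_(x in [set x | (0 < rho x)%R]) g (rho x) =
         O%:E * \int[@lebesgue_measure R]_(r in `]0%R, +oo[) g r)%E].

(** This instance lets the bound for the Laplace transform be used in both directions, from the
    group to the variable s and back. *)
Lemma gauge_half_line (R : realType) :
  gauge (@lebesgue_measure R) (fun x : measurableTypeR R => x : R) 1.
Proof.
split => // g mg g0; rewrite mul1e; congr integral.
by apply/seteqP; split => x /=; rewrite in_itv/= andbT.
Qed.

(** The domain is rho > 0 because the laws of exponents for [powR], such as [powRD], can fail at
    0. *)
Definition laplace d (T : measurableType d) (R : realType)
    (mu : {measure set T -> \bar R}) (rho : T -> R) (g : T -> R) (s : R) : \bar R :=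
  (\int[mu]_(x in [set x | (0 < rho x)%R]) (g x * expR (- (s * rho x)))%:E)%E.

(** * Laplace transforms with respect to a gauge *)

Section gauge_theory.
Context d (T : measurableType d) (R : realType).
Variables (mu : {measure set T -> \bar R}) (rho : T -> R) (O : R).
Hypothesis grho : gauge mu rho O.

Local Notation D := [set x | 0 < rho x].

Lemma measurable_gauge : measurable_fun setT rho. Proof. by case: grho. Qed.

Lemma gauge_gt0 : 0 < O. Proof. by case: grho. Qed.

Lemma measurable_gauge_gt0 : measurable D.
Proof.
have -> : D = setT `&` rho @^-1` `]0, +oo[.
  by rewrite setTI; apply/seteqP; split => x /=; rewrite in_itv/= andbT.
by apply: measurable_gauge => //; exact: measurable_itv.
Qed.

Lemma measurable_expRN_gauge s : measurable_fun setT (fun x => expR (- (s * rho x))).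
Proof.
apply: measurableT_comp => //; apply: measurableT_comp => //.
by apply: measurable_funM => //; exact: measurable_gauge.
Qed.

Lemma gauge_gamma_integral a s : 0 < a -> 0 < s ->
  (\int[mu]_(x in D) (rho x `^ (a - 1) * expR (- (s * rho x)))%:E =
   (O * Gamma a * s `^ (- a))%:E)%E.
Proof.
move=> a0 s0; have [_ _ polar] := grho.
rewrite (polar (fun r => (r `^ (a - 1) * expR (- (s * r)))%:E)); last 2 first.
- by apply/measurable_EFinP; exact: measurable_gamma_integrand.
- by move=> r; rewrite lee_fin mulr_ge0 ?powR_ge0 ?expR_ge0.
by rewrite gamma_integralE// -EFinM -mulrA (mulrC (Gamma _)).
Qed.

Lemma laplace_ge0 (g : T -> R) s : (forall x, 0 <= g x) -> (0 <= laplace mu rho g s)%E.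
Proof. by move=> g0; apply: integral_ge0 => x _; rewrite lee_fin mulr_ge0 ?expR_ge0. Qed.

Section one_function.
Variables (g : T -> R) (p a : R).
Hypotheses (mg : measurable_fun setT g) (g0 : forall x, 0 <= g x).
Hypotheses (p1 : 1 < p) (a0 : 0 < a).

(** The pointwise half of Schur's test. The integrand is split as g rho^(1-a) times the density
    rho^(a-1) exp(-s rho), whose total mass is O Gamma(a) s^(-a), and Hoelder's inequality is
    applied for that density. *)
Lemma laplace_powR_le s : 0 < s ->
  (laplace mu rho g s `^ p <= ((O * Gamma a * s `^ (- a)) `^ (p - 1))%:E *
   \int[mu]_(x in D) ((g x `^ p * rho x `^ (p * (1 - a) + (a - 1))) *
     expR (- (s * rho x)))%:E)%E.
Proof.
move=> s0; have mrho := measurable_gauge; have mD := measurable_gauge_gt0.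
have mw : measurable_fun setT (fun x => rho x `^ (a - 1) * expR (- (s * rho x))).
  by apply: measurable_funM; [exact: measurable_powR_comp|exact: measurable_expRN_gauge].
have mh : measurable_fun setT (fun x => g x * rho x `^ (1 - a)).
  by apply: measurable_funM => //; exact: measurable_powR_comp.
have h0 x : D x -> 0 <= g x * rho x `^ (1 - a) by rewrite mulr_ge0 ?powR_ge0.
have w0 x : D x -> 0 <= rho x `^ (a - 1) * expR (- (s * rho x)).
  by rewrite mulr_ge0 ?powR_ge0 ?expR_ge0.
have := ge0_integral_powR_le mu p1 mD mh mw h0 w0.
rewrite gauge_gamma_integral// poweR_EFin.
have -> : (\int[mu]_(x in D) (g x * rho x `^ (1 - a) *
    (rho x `^ (a - 1) * expR (- (s * rho x))))%:E = laplace mu rho g s)%E.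
  apply: eq_integral => x; rewrite inE/= => x0; congr EFin.
  rewrite !mulrA -(mulrA (g x)) -powRD ?(gt_eqF x0) ?implybT//.
  by rewrite (_ : 1 - a + (a - 1) = 0) ?powRr0 ?mulr1//; ring.
move/le_trans; apply; rewrite le_eqVlt; apply/orP; left; apply/eqP; congr (_ * _)%E.
apply: eq_integral => x; rewrite inE/= => x0; congr EFin.
rewrite powRM ?powR_ge0// -powRrM !mulrA; congr (_ * _).
rewrite -!mulrA; congr (_ * _); rewrite -powRD ?(gt_eqF x0) ?implybT//.
by rewrite (mulrC (1 - a)).
Qed.

(** The weight in [laplace_powR_le] is that of the hypothesis times rho^a exp(-s rho), which is
    bounded for fixed s. Finiteness allows the transforms to be handled later as real-valued
    functions. *)
Lemma laplace_lty s : 0 < s ->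
  (\int[mu]_(x in D) (g x `^ p * rho x `^ (p * (1 - a) - 1))%:E < +oo)%E ->
  (laplace mu rho g s < +oo)%E.
Proof.
move=> s0 foo; have mrho := measurable_gauge; have mD := measurable_gauge_gt0.
have p0 : p != 0 by rewrite gt_eqF// (lt_trans _ p1).
apply: (lty_poweRy p0); apply: le_lt_trans (laplace_powR_le s0) _.
apply: lte_mul_pinfty => //; first by rewrite lee_fin powR_ge0.
have mgp : measurable_fun setT (fun x => g x `^ p) by exact: measurable_powR_comp.
have mrp b : measurable_fun setT (fun x => rho x `^ b) by exact: measurable_powR_comp.
have mG : measurable_fun setT (fun x => (g x `^ p * rho x `^ (p * (1 - a) - 1))%:E).
  by apply/measurable_EFinP; exact: measurable_funM.
apply: (@le_lt_trans _ _ (\int[mu]_(x in D) (((a / s) `^ a)%:E *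
    (g x `^ p * rho x `^ (p * (1 - a) - 1))%:E))%E).
  apply: ge0_le_integral => //.
  - by move=> x _; rewrite lee_fin !mulr_ge0 ?powR_ge0 ?expR_ge0.
  - apply/measurable_EFinP; apply: measurable_funTS.
    by apply: measurable_funM; [exact: measurable_funM|exact: measurable_expRN_gauge].
  - by apply: emeasurable_funM => //; exact: measurable_funTS.
  move=> x /= x0; rewrite -EFinM lee_fin.
  rewrite (_ : p * (1 - a) + (a - 1) = (p * (1 - a) - 1) + a); last by ring.
  rewrite powRD ?(gt_eqF x0) ?implybT// mulrA -(mulrA (_ * _)) mulrC.
  by rewrite ler_wpM2r ?mulr_ge0 ?powR_ge0// powR_expRN_le// ltW.
rewrite ge0_integralZl_EFin ?powR_ge0//; last 2 first.
- by move=> x _; rewrite lee_fin mulr_ge0 ?powR_ge0.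
- exact: measurable_funTS.
by apply: lte_mul_pinfty => //; rewrite lee_fin powR_ge0.
Qed.

End one_function.
End gauge_theory.

(** * Schur's test for the Laplace transform between two gauges *)

Section laplace_bound.
Context dX (X : measurableType dX) dY (Y : measurableType dY) (R : realType).
Variables (mX : {sigma_finite_measure set X -> \bar R}) (rX : X -> R) (OX : R).
Variables (mY : {sigma_finite_measure set Y -> \bar R}) (rY : Y -> R) (OY : R).
Hypotheses (gX : gauge mX rX OX) (gY : gauge mY rY OY).

Let measurable_kernel (g : X -> R) : measurable_fun setT g ->
  measurable_fun setT (fun z : Y * X => (g z.2 * expR (- (rY z.1 * rX z.2)))%:E).
Proof.
move=> mg; apply/measurable_EFinP; apply: measurable_funM.
  exact: measurableT_comp mg measurable_snd.
apply: measurableT_comp => //; apply: measurableT_comp => //.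
apply: measurable_funM.
  exact: measurableT_comp (measurable_gauge gY) measurable_fst.
exact: measurableT_comp (measurable_gauge gX) measurable_snd.
Qed.

Lemma measurable_laplace_gauge (g : X -> R) :
  measurable_fun setT g -> (forall x, 0 <= g x) ->
  measurable_fun setT (fun y => laplace mX rX g (rY y)).
Proof.
move=> mg g0.
apply: (measurable_fun_integral_in mX (measurable_gauge_gt0 gX) (measurable_kernel mg)).
by move=> z; rewrite lee_fin mulr_ge0 ?expR_ge0.
Qed.

(* Schur's test for the kernel exp(-rX rY) with the weight rX^(a-1). *)
Lemma laplace_bound (g : X -> R) p a :
  measurable_fun setT g -> (forall x, 0 <= g x) -> 1 < p -> 0 < a ->
  (\int[mY]_(y in [set y | (0 < rY y)%R])
     (laplace mX rX g (rY y) `^ p * (rY y `^ (p * a - 1))%:E) <=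
   (OX `^ (p - 1) * OY * Gamma a `^ p)%:E *
   \int[mX]_(x in [set x | (0 < rX x)%R])
     (g x `^ p * rX x `^ (p * (1 - a) - 1))%:E)%E.
Proof.
move=> mg g0 p1 a0.
have Ga := Gamma_gt0 a0; have OX0 := gauge_gt0 gX; have OY0 := gauge_gt0 gY.
have mDX := measurable_gauge_gt0 gX; have mDY := measurable_gauge_gt0 gY.
have mrX := measurable_gauge gX; have mrY := measurable_gauge gY.
pose G x := g x `^ p * rX x `^ (p * (1 - a) + (a - 1)).
have mG : measurable_fun setT G.
  by apply: measurable_funM; exact: measurable_powR_comp.
have G0 x : 0 <= G x by rewrite mulr_ge0 ?powR_ge0.
have C0 : 0 <= (OX * Gamma a) `^ (p - 1) by exact: powR_ge0.
have mk : measurable_fun setT (fun z : Y * X =>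
    ((rY z.1 `^ (a - 1))%:E * (G z.2 * expR (- (rY z.1 * rX z.2)))%:E)%E).
  apply: emeasurable_funM; last exact: measurable_kernel.
  apply/measurable_EFinP; exact: measurableT_comp (measurable_powR_comp _ mrY) measurable_fst.
have mL : measurable_fun setT (fun y => (rY y `^ (a - 1))%:E * laplace mX rX G (rY y))%E.
  apply: emeasurable_funM; last exact: measurable_laplace_gauge.
  by apply/measurable_EFinP; exact: measurable_powR_comp.
(* The exponents of rY combine to -a (p - 1) + (p a - 1) = a - 1, so that after exchanging the
   integrals the one over [Y] is again a Gamma integral of parameter a. *)
apply: (@le_trans _ _ (\int[mY]_(y in [set y | (0 < rY y)%R])
    (((OX * Gamma a) `^ (p - 1))%:E * ((rY y `^ (a - 1))%:E * laplace mX rX G (rY y))))%E).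
  apply: ge0_le_integral => //.
  - by move=> y _; rewrite mule_ge0 ?poweR_ge0 ?lee_fin ?powR_ge0.
  - apply: measurable_funTS; apply: emeasurable_funM.
      by apply: (measurableT_comp (measurable_poweR p)); exact: measurable_laplace_gauge.
    by apply/measurable_EFinP; exact: measurable_powR_comp.
  - by apply: emeasurable_funM => //; exact: measurable_funTS.
  move=> y /= y0.
  apply: (@le_trans _ _ ((((OX * Gamma a * rY y `^ (- a)) `^ (p - 1))%:E *
     laplace mX rX G (rY y)) * (rY y `^ (p * a - 1))%:E)%E).
    by apply: lee_wpmul2r; rewrite ?lee_fin ?powR_ge0//; exact: laplace_powR_le.
  rewrite muleAC muleA -!EFinM powRM ?powR_ge0 ?mulr_ge0 ?(ltW OX0) ?(ltW Ga)//.
  rewrite -powRrM -mulrA -powRD ?(gt_eqF y0) ?implybT//.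
  by rewrite (_ : - a * (p - 1) + (p * a - 1) = a - 1)//; ring.
rewrite ge0_integralZl_EFin//; last 2 first.
- by move=> y _; rewrite mule_ge0 ?lee_fin ?powR_ge0 ?laplace_ge0.
- exact: measurable_funTS.
have -> : (\int[mY]_(y in [set y | (0 < rY y)%R])
    ((rY y `^ (a - 1))%:E * laplace mX rX G (rY y)) =
  \int[mY]_(y in [set y | (0 < rY y)%R]) \int[mX]_(x in [set x | (0 < rX x)%R])
    ((rY y `^ (a - 1))%:E * (G x * expR (- (rY y * rX x)))%:E))%E.
  apply: eq_integral => y _; rewrite ge0_integralZl_EFin ?powR_ge0//.
  - by move=> x _; rewrite lee_fin mulr_ge0 ?expR_ge0.
  - apply: measurable_funTS; apply/measurable_EFinP; apply: measurable_funM => //.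
    exact: measurable_expRN_gauge gX _.
rewrite (@fubini_tonelli_in _ _ _ _ _ mY mX _ _ (fun z : Y * X =>
    ((rY z.1 `^ (a - 1))%:E * (G z.2 * expR (- (rY z.1 * rX z.2)))%:E)%E))//; last first.
  by move=> z; apply: mule_ge0; rewrite lee_fin ?powR_ge0// mulr_ge0 ?expR_ge0.
have mg1 : measurable_fun setT (fun x => (g x `^ p * rX x `^ (p * (1 - a) - 1))%:E).
  by apply/measurable_EFinP; apply: measurable_funM; exact: measurable_powR_comp.
(* The inner integral equals OY Gamma(a) rX^(-a). It turns the weight exponent p (1 - a) + (a - 1)
   into p (1 - a) - 1 and completes Gamma(a)^(p-1) to Gamma(a)^p. *)
have -> : (\int[mX]_(x in [set x | (0 < rX x)%R]) \int[mY]_(y in [set y | (0 < rY y)%R])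
    ((rY y `^ (a - 1))%:E * (G x * expR (- (rY y * rX x)))%:E) =
  \int[mX]_(x in [set x | (0 < rX x)%R])
    ((OY * Gamma a)%:E * (g x `^ p * rX x `^ (p * (1 - a) - 1))%:E))%E.
  apply: eq_integral => x; rewrite inE/= => x0.
  under eq_integral => y _ do rewrite -EFinM mulrCA (mulrC (rY y)) EFinM.
  rewrite ge0_integralZl_EFin//; last 2 first.
  - by move=> y _; rewrite lee_fin mulr_ge0 ?powR_ge0 ?expR_ge0.
  - apply: measurable_funTS; apply/measurable_EFinP; apply: measurable_funM.
      exact: measurable_powR_comp.
    exact: measurable_expRN_gauge gY _.
  rewrite (gauge_gamma_integral gY)// -!EFinM; congr EFin.
  rewrite mulrCA /G -(mulrA (g x `^ p)) -powRD ?(gt_eqF x0) ?implybT//.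
  by rewrite (_ : p * (1 - a) + (a - 1) - a = p * (1 - a) - 1)//; ring.
rewrite ge0_integralZl_EFin ?mulr_ge0 ?(ltW OY0) ?(ltW Ga)//; last 2 first.
- by move=> x _; rewrite lee_fin mulr_ge0 ?powR_ge0.
- exact: measurable_funTS.
rewrite muleA -EFinM powRM ?(ltW OX0) ?(ltW Ga)// le_eqVlt; apply/orP; left; apply/eqP.
congr (_%:E * _)%E; rewrite -(mulr_powRB1 (ltW Ga) (lt_trans ltr01 p1)).
by ring.
Qed.

End laplace_bound.

(** * Integrals over product measures and the factorized kernel *)

Section product_integral.
Context d (T : measurableType d) (R : realType).
Variable mu : {sigma_finite_measure set T -> \bar R}.

Lemma ge0_integral_pow_measureS k (f : k.+1.-tuple T -> \bar R) :
  measurable_fun setT f -> (forall t, (0 <= f t)%E) ->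
  (\int[pow_measure mu k.+1]_t f t =
   \int[mu]_x \int[pow_measure mu k]_t f (tcons (x, t)))%E.
Proof.
move=> mf f0.
have mt := @measurable_tcons _ T k.
transitivity (\int[measure_function_pushforward__canonical__measure_function_Measure
    (mu \x pow_measure mu k)%E mt]_t f t)%E.
  by apply: eq_measure_integral.
rewrite (ge0_integral_pushforward mt)// preimage_setT.
rewrite fubini_tonelli1//; first exact: measurableT_comp.
by move=> z; exact: f0.
Qed.

Lemma ge0_integral_pow_measure_prod k (f : 'I_k -> T -> R) :
  (forall j, measurable_fun setT (f j)) -> (forall j x, 0 <= f j x) ->
  (\int[pow_measure mu k]_t (\prod_(j < k) f j (tnth t j))%:E =
   \prod_(j < k) \int[mu]_x (f j x)%:E)%E.
Proof.
elim: k f => [|k IH] f mf f0.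
  under eq_integral do rewrite big_ord0.
  by rewrite integral_cst// mul1e big_ord0 /= diracT.
have mprod l (g : 'I_l -> T -> R) : (forall j, measurable_fun setT (g j)) ->
    measurable_fun setT (fun t : l.-tuple T => (\prod_(j < l) g j (tnth t j))%:E).
  move=> mg; apply/measurable_EFinP; apply: measurable_bigprod => j.
  exact: measurableT_comp (mg j) (measurable_tnth j).
rewrite ge0_integral_pow_measureS; [|exact: mprod|by move=> t; rewrite lee_fin; apply: prodr_ge0].
transitivity (\int[mu]_x ((f ord0 x)%:E *
    \prod_(j < k) \int[mu]_x (f (lift ord0 j) x)%:E))%E.
  apply: eq_integral => x _.
  transitivity (\int[pow_measure mu k]_t ((f ord0 x)%:E *
      (\prod_(j < k) f (lift ord0 j) (tnth t j))%:E))%E.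
    apply: eq_integral => t _; rewrite big_ord_recl tnth0 EFinM.
    by under eq_bigr do rewrite tnthS.
  rewrite ge0_integralZl_EFin//; last 2 first.
  - by move=> t _; rewrite lee_fin; apply: prodr_ge0.
  - by apply: (mprod k (fun j => f (lift ord0 j))).
  by rewrite (IH (fun j => f (lift ord0 j))).
rewrite ge0_integralZr//.
- by rewrite big_ord_recl.
- exact/measurable_EFinP.
- by move=> x _; rewrite lee_fin.
- by apply: prode_ge0 => j _; apply: integral_ge0 => x _; rewrite lee_fin.
Qed.

Variables (rho : T -> R) (O : R).
Hypotheses (grho : gauge mu rho O) (rho_ge0 : forall x, 0 <= rho x).
Hypothesis rho_null : mu [set x | rho x = 0] = 0%E.

Lemma ge0_integral_gauge_gt0 (f : T -> \bar R) : measurable_fun setT f ->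
  (forall x, (0 <= f x)%E) ->
  (\int[mu]_x f x = \int[mu]_(x in [set x | (0 < rho x)%R]) f x)%E.
Proof.
move=> mf f0.
have mN : measurable [set x | rho x = 0].
  have -> : [set x | rho x = 0] = setT `&` rho @^-1` [set 0] by rewrite setTI.
  by apply: (measurable_gauge grho) => //; exact: measurable_set1.
have -> : [set x | (0 < rho x)%R] = setT `\` [set x | rho x = 0].
  apply/seteqP; split => x /=.
    by move=> x0; split => //; apply/eqP; rewrite gt_eqF.
  by move=> [_ /eqP x0]; rewrite lt0r x0 rho_ge0.
by rewrite -ge0_negligible_integral.
Qed.

Lemma integral_laplace (g : T -> R) s : measurable_fun setT g ->
  (forall x, 0 <= g x) ->
  (\int[mu]_x (g x * expR (- (s * rho x)))%:E = laplace mu rho g s)%E.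
Proof.
move=> mg g0; rewrite ge0_integral_gauge_gt0//.
  apply/measurable_EFinP; apply: measurable_funM => //.
  exact: measurable_expRN_gauge grho _.
by move=> x; rewrite lee_fin mulr_ge0 ?expR_ge0.
Qed.

(* S^-m is the Laplace transform of s^(m-1) / Gamma m, which factorizes the kernel. *)
Lemma multilinear_kernelE (m : nat) (f : 'I_m -> T -> R) S0 : (0 < m)%N -> 0 < S0 ->
  (forall j, measurable_fun setT (f j)) -> (forall j x, 0 <= f j x) ->
  (\int[pow_measure mu m]_y
     ((\prod_(j < m) f j (tnth y j)) / (S0 + \sum_(j < m) rho (tnth y j)) ^+ m)%:E =
   ((Gamma m%:R)^-1)%:E * \int[@lebesgue_measure R]_(s in `]0%R, +oo[)
     ((s `^ (m%:R - 1) * expR (- (s * S0)))%:E * \prod_(j < m) laplace mu rho (f j) s))%E.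
Proof.
move=> m0 S0gt0 mf f0.
have mR : 0 < m%:R :> R by rewrite ltr0n.
have Gm := Gamma_gt0 mR.
pose S (y : m.-tuple T) := S0 + \sum_(j < m) rho (tnth y j).
have Sgt0 y : 0 < S y by rewrite ltr_pwDl// sumr_ge0.
have mS : measurable_fun setT S.
  apply: measurable_funD => //; apply: measurable_bigsum => j.
  exact: measurableT_comp (measurable_gauge grho) (measurable_tnth j).
pose F y := \prod_(j < m) f j (tnth y j).
have mF : measurable_fun setT F.
  by apply: measurable_bigprod => j; exact: measurableT_comp (mf j) (measurable_tnth j).
have F0 y : 0 <= F y by apply: prodr_ge0.
have mm : measurable_fun setT (fun z : m.-tuple T * measurableTypeR R =>
    (F z.1 * (z.2 `^ (m%:R - 1) * expR (- (S z.1 * z.2))))%:E).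
  apply/measurable_EFinP; apply: measurable_funM.
    exact: measurableT_comp mF measurable_fst.
  apply: measurable_funM.
    exact: measurableT_comp (measurable_powR _) measurable_snd.
  apply: measurableT_comp => //; apply: measurableT_comp => //.
  apply: measurable_funM => //; exact: measurableT_comp mS measurable_fst.
transitivity (\int[pow_measure mu m]_y (((Gamma m%:R)^-1)%:E *
    \int[@lebesgue_measure R]_(s in `]0%R, +oo[)
      (F y * (s `^ (m%:R - 1) * expR (- (S y * s))))%:E))%E.
  apply: eq_integral => y _.
  under [in RHS]eq_integral do rewrite EFinM.
  rewrite ge0_integralZl_EFin//; last 2 first.
  - by move=> s _; rewrite lee_fin mulr_ge0 ?powR_ge0 ?expR_ge0.
  - by apply: measurable_funTS; apply/measurable_EFinP; exact: measurable_gamma_integrand.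
  rewrite gamma_integralE// -!EFinM; congr EFin.
  rewrite powRN powR_mulrn ?(ltW (Sgt0 _))// -/(S y) -/(F y).
  by field; rewrite !gt_eqF ?exprn_gt0.
rewrite ge0_integralZl_EFin ?invr_ge0 ?(ltW Gm)//; last 2 first.
- move=> y _; apply: integral_ge0 => s _.
  by rewrite lee_fin !mulr_ge0 ?powR_ge0 ?expR_ge0.
- apply: (measurable_fun_integral_in (@lebesgue_measure R) _ mm) => //.
  by move=> z; rewrite lee_fin !mulr_ge0 ?powR_ge0 ?expR_ge0.
congr (_ * _)%E.
rewrite (@fubini_tonelli_in _ _ _ _ _ (pow_measure mu m) (@lebesgue_measure R) setT _ _ _ _ mm)//; last first.
  by move=> z; rewrite lee_fin !mulr_ge0 ?powR_ge0 ?expR_ge0.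
apply: eq_integral => s _ /=.
transitivity (\int[pow_measure mu m]_y ((s `^ (m%:R - 1) * expR (- (s * S0)))%:E *
    (\prod_(j < m) (f j (tnth y j) * expR (- (s * rho (tnth y j)))))%:E))%E.
  apply: eq_integral => y _; rewrite -EFinM; congr EFin.
  rewrite big_split/= -expR_sum mulrCA -!mulrA; congr (_ * _).
  rewrite mulrCA; congr (_ * _); rewrite -expRD; congr expR.
  by rewrite sumrN -mulr_sumr /S; ring.
rewrite ge0_integralZl_EFin ?mulr_ge0 ?powR_ge0 ?expR_ge0//; last 2 first.
- by move=> y _; rewrite lee_fin; apply: prodr_ge0 => j _; rewrite mulr_ge0 ?expR_ge0.
- apply/measurable_EFinP; apply: measurable_bigprod => j.
  apply: measurable_funM; first exact: measurableT_comp (mf j) (measurable_tnth j).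
  exact: measurableT_comp (measurable_expRN_gauge grho s) (measurable_tnth j).
congr (_ * _)%E.
rewrite (ge0_integral_pow_measure_prod (f := fun j x => f j x * expR (- (s * rho x)))).
- by apply: eq_bigr => j _; exact: integral_laplace.
- by move=> j; apply: measurable_funM => //; exact: measurable_expRN_gauge grho _.
- by move=> j x; rewrite mulr_ge0 ?expR_ge0.
Qed.

End product_integral.

(** * Coordinatewise scaling of the product measure *)

Section pow_measure_scale.
Variable R : realType.
Local Notation leb := (@lebesgue_measure R).

(** The factors are indexed by [nat] rather than by ordinals, so that removing the first coordinate
    is precomposition with [S]. *)
Definition tscale k (c : nat -> R) (t : k.-tuple (measurableTypeR R)) :
    k.-tuple (measurableTypeR R) :=
  [tuple c i * tnth t i | i < k].

Lemma measurable_tscale k (c : nat -> R) : measurable_fun setT (@tscale k c).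
Proof.
apply/measurable_fun_tnthP => i; rewrite /comp.
under eq_fun do rewrite tnth_mktuple.
apply: measurable_funM => //; exact: measurable_tnth.
Qed.

Lemma tscale_tcons k (c : nat -> R) (x : measurableTypeR R) (t : k.-tuple _) :
  tscale c (tcons (x, t)) = tcons (c 0 * x, tscale (c \o S) t).
Proof.
apply: eq_from_tnth => i; rewrite tnth_mktuple.
by case: (unliftP ord0 i) => [j|] ->; rewrite ?tnth0// !tnthS tnth_mktuple.
Qed.

(** Tonelli's theorem peels off one coordinate at a time, each contributing its own factor.
    Functions are used instead of sets because the inner integral of a slice is itself a function of
    the first coordinate. *)
Lemma ge0_integral_pow_measure_scale k (c : nat -> R)
    (f : k.-tuple (measurableTypeR R) -> \bar R) :
  (forall i, 0 < c i) -> measurable_fun setT f -> (forall t, (0 <= f t)%E) ->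
  (\int[pow_measure leb k]_t f (tscale c t) =
   (\prod_(i < k) c i)^-1%:E * \int[pow_measure leb k]_t f t)%E.
Proof.
elim: k c f => [|k IH] c f c0 mf f0.
  rewrite big_ord0 invr1 mul1e; apply: eq_integral => t _; congr f.
  by apply: eq_from_tnth => -[].
have mfs : measurable_fun setT (f \o tscale c).
  exact: measurableT_comp mf (measurable_tscale c).
have mft : measurable_fun setT (f \o @tcons _ _ k).
  exact: measurableT_comp mf (@measurable_tcons _ _ k).
rewrite (ge0_integral_pow_measureS leb mfs (fun t => f0 _)) (ge0_integral_pow_measureS leb mf f0).
pose P := \prod_(i < k) c i.+1.
have P0 : 0 < P by apply: prodr_gt0.
pose F x := (\int[pow_measure leb k]_t f (tcons (x, t)))%E.
have mF : measurable_fun setT F.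
  by apply: (measurable_fun_integral_in (pow_measure leb k) measurableT mft) => z; exact: f0.
have F0 x : (0 <= F x)%E by apply: integral_ge0.
transitivity (\int[leb]_x (P^-1%:E * F (c 0 * x)%R))%E.
  apply: eq_integral => x _; rewrite /comp.
  under eq_integral do rewrite tscale_tcons.
  rewrite (IH (c \o S) (fun t => f (tcons (c 0 * x, t))))//.
  - by move=> i; exact: c0.
  - by apply: (measurableT_comp mft); exact: measurable_pair1.
rewrite ge0_integralZl_EFin; last 4 first.
- exact: measurableT.
- by move=> x _; exact: F0.
- exact: (measurableT_comp mF (mulrl_measurable (c 0))).
- by rewrite invr_ge0 ltW.
have := @ge0_integral_lebesgue_scale R (c 0) setT F (c0 0) measurableT mF (fun x _ => F0 x).
rewrite preimage_setT => ->; rewrite muleA -EFinM big_ord_recl invfM (mulrC P^-1).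
by [].
Qed.

End pow_measure_scale.

(** * The homogeneous norm and its dilations *)

Section heisenberg_polar.
Variables (R : realType) (n : nat).
Local Notation H := (heisenberg R n).
Local Notation Q := (hdim n).
Local Notation mu := (hmeasure R n).
Local Notation leb := (@lebesgue_measure R).
Implicit Types (x : H) (r s : R).

(** The exponent Q makes the volume of a sublevel set linear in its level, so the image measure has
    constant density. *)
Definition hrho x : R := hnorm x ^+ Q.

Lemma hnorm_ge0 x : 0 <= hnorm x. Proof. exact: powR_ge0. Qed.

Lemma hrho_ge0 x : 0 <= hrho x. Proof. by rewrite exprn_ge0// hnorm_ge0. Qed.

Lemma measurable_hcoord i : measurable_fun setT (fun x => hcoord x i).
Proof. exact: measurable_tnth. Qed.

Lemma measurable_hnorm : measurable_fun setT (@hnorm R n).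
Proof.
apply: measurable_powR_comp; apply: measurable_funD.
  apply: (measurable_funX 2); apply: measurable_bigsum => i.
  by apply: (measurable_funX 2); exact: measurable_hcoord.
by apply: (measurable_funX 2); exact: measurable_hcoord.
Qed.

Lemma measurable_hrho : measurable_fun setT hrho.
Proof. by apply: (measurable_funX Q); exact: measurable_hnorm. Qed.

Lemma hpowerE a x : hpower a x = hrho x `^ (a / Q%:R).
Proof.
have Q0 : Q%:R != 0 :> R by rewrite pnatr_eq0.
rewrite /hpower /hrho -(powR_mulrn _ (hnorm_ge0 x)) -powRrM.
by congr powR; rewrite mulrCA divff// mulr1.
Qed.

Definition hdil s x : H := tscale (fun i => if (i < n.*2)%N then s else s ^+ 2) x.

Lemma hnorm_dil s x : 0 < s -> hnorm (hdil s x) = s * hnorm x.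
Proof.
move=> s0; rewrite /hnorm /hcoord tnth_mktuple /= ltnn.
under eq_bigr => i _ do rewrite tnth_mktuple /= ltn_ord exprMn.
rewrite -mulr_sumr !exprMn -mulrDr powRM; last 2 first.
- by rewrite mulr_ge0 ?sqr_ge0.
- by rewrite addr_ge0 ?sqr_ge0.
congr (_ * _%R); have s0' := ltW s0.
rewrite -exprD -(powR_mulrn _ s0') -powRrM divff ?powRr1//.
Qed.

Lemma hmeasure_hnorm_lt r : 0 < r ->
  mu [set x | hnorm x < r] = ((r ^+ Q)%:E * Omega_Q R n)%E.
Proof.
move=> r0; have ri0 : 0 < r^-1 by rewrite invr_gt0.
have mlt u : measurable [set x : H | hnorm x < u].
  have -> : [set x : H | hnorm x < u] = setT `&` @hnorm R n @^-1` `]-oo, u[.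
    by rewrite setTI; apply/seteqP; split => x /=; rewrite in_itv.
  by apply: measurable_hnorm => //; exact: measurable_itv.
(* The dilation by 1/r, which carries the ball of radius r to the unit ball: 2n factors r^(-1) and
   one factor r^(-2), with product r^(-Q). *)
pose c i := if (i < n.*2)%N then r^-1 else r^-1 ^+ 2.
have c0 i : 0 < c i by rewrite /c; case: ifP => _; rewrite ?exprn_gt0.
pose B := [set x : H | hnorm x < 1].
have mind : measurable_fun setT (fun x : H => (\1_B x)%:E : \bar R).
  by apply/measurable_EFinP; apply: measurable_indic; exact: mlt.
have ind0 (x : H) : (0 <= (\1_B x)%:E :> \bar R)%E by rewrite lee_fin.
have -> : Omega_Q R n = (\int[mu]_x (\1_B x)%:E)%E.
  by rewrite integral_indic ?setIT//; exact: mlt.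
have -> : mu [set x | hnorm x < r] = (\int[mu]_x (\1_B (tscale c x))%:E)%E.
  rewrite -[in LHS](setIT [set x | hnorm x < r]) -integral_indic; [|exact: measurableT|exact: mlt].
  apply: eq_integral => x _; congr EFin; rewrite !indicE; congr (nat_of_bool _)%:R.
  have -> : (tscale c x \in B) = (hnorm (hdil r^-1 x) < 1).
    by apply/idP/idP; rewrite inE.
  rewrite hnorm_dil// mulrC ltr_pdivrMr// mul1r.
  by apply/idP/idP; rewrite inE.
rewrite (ge0_integral_pow_measure_scale c0 mind ind0); congr (_%:E * _)%E.
rewrite big_ord_recr/= /c ltnn (eq_bigr (fun=> r^-1)); last first.
  by move=> i _ /=; rewrite ltn_ord.
by rewrite prodr_const card_ord -exprD addn2 exprVn invrK.
Qed.

End heisenberg_polar.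

(** * Integration in polar form on the Heisenberg group *)

Section heisenberg_gauge.
Variables (R : realType) (n : nat).
Local Notation H := (heisenberg R n).
Local Notation Q := (hdim n).
Local Notation mu := (hmeasure R n).
Local Notation leb := (@lebesgue_measure R).
Implicit Types (x : H) (r s : R).

Lemma measurable_hnorm_lt r : measurable [set x : H | hnorm x < r].
Proof.
have -> : [set x : H | hnorm x < r] = setT `&` @hnorm R n @^-1` `]-oo, r[.
  by rewrite setTI; apply/seteqP; split => x /=; rewrite in_itv.
by apply: measurable_hnorm => //; exact: measurable_itv.
Qed.

Lemma hmeasure_cube c : 0 < c ->
  mu [set x | forall i, `[- c, c]%classic (tnth x i)] = ((c + c) ^+ n.*2.+1)%:E.
Proof.
move=> c0; have E := @pow_measureX _ (measurableTypeR R) R leb n.*2.+1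
  (fun=> `[- c, c]%classic) (fun=> measurable_itv _).
apply: (etrans E).
rewrite (eq_bigr (fun=> (c + c)%:E)) => [|i _].
  by rewrite prodEFin prodr_const card_ord.
rewrite [LHS]lebesgue_measure_itv/= lte_fin ifT ?opprK//.
by rewrite (lt_trans _ c0)// oppr_lt0.
Qed.

Lemma measurable_cube c :
  measurable [set x : H | forall i, `[- c, c]%classic (tnth x i)].
Proof.
have -> : [set x : H | forall i, `[- c, c]%classic (tnth x i)] =
    \bigcap_(i in [set: 'I_n.*2.+1]) ((@tnth _ _ ^~ i) @^-1` `[- c, c]%classic).
  by apply/seteqP; split => t /= At i; [move=> _|]; exact: At.
apply: fin_bigcap_measurable => // i _.
by rewrite -[X in measurable X]setTI; apply: measurable_tnth.
Qed.

Lemma hnorm_lt1 x : (hnorm x < 1) =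
  ((\sum_(i < n.*2) hcoord x (widen_ord (leqnSn _) i) ^+ 2) ^+ 2
   + hcoord x ord_max ^+ 2 < 1).
Proof.
set A := _ + _; have A0 : 0 <= A by rewrite addr_ge0 ?sqr_ge0.
have q0 : 0 < 4^-1 :> R by rewrite invr_gt0.
rewrite /hnorm -/A; apply/idP/idP => h; rewrite ltNge; apply/negP => h1.
  have := ge0_ler_powR (ltW q0) _ _ h1; rewrite !nnegrE ler01 A0 => /(_ isT isT).
  by rewrite powR1 leNgt h.
have := gt0_ltr_powR q0 _ _ h; rewrite !nnegrE ler01 A0 => /(_ isT isT).
by rewrite powR1 ltNge h1.
Qed.

Lemma Omega_Q_lty : (Omega_Q R n < +oo)%E.
Proof.
apply: (@le_lt_trans _ _ (mu [set x | forall i, `[- 1, 1]%classic (tnth x i)])).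
  apply: le_measure; rewrite ?inE; [exact: measurable_hnorm_lt|exact: measurable_cube|].
  move=> x; rewrite /hball1/= hnorm_lt1 => h i.
  suff : tnth x i ^+ 2 <= 1.
    by rewrite /= in_itv/= -ler_norml -real_normK ?num_real// expr_le1.
  have S0 : 0 <= \sum_(j < n.*2) hcoord x (widen_ord (leqnSn _) j) ^+ 2.
    by apply: sumr_ge0 => j _; exact: sqr_ge0.
  case: (unliftP ord_max i) => [j|] ->; last first.
    by apply: le_trans (ltW h); rewrite lerDr sqr_ge0.
  have -> : lift ord_max j = widen_ord (leqnSn _) j by apply/val_inj; rewrite /= /bump leqNgt ltn_ord.
  apply: (@le_trans _ _ (\sum_(j < n.*2) hcoord x (widen_ord (leqnSn _) j) ^+ 2)).
    by rewrite (bigD1 j)//= lerDl; apply: sumr_ge0 => k _; exact: sqr_ge0.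
  rewrite -(expr_le1 (n := 2))//.
  by apply: le_trans (ltW h); rewrite lerDl sqr_ge0.
by rewrite hmeasure_cube// ltry.
Qed.

Lemma Omega_Q_gt0 : (0 < Omega_Q R n)%E.
Proof.
(* This half-side puts the cube inside the unit ball: the 2n horizontal squares add up to at most 2n
   c^2 <= c <= 1/2, so the fourth power of the norm is at most 2 c^2 <= 1/2. *)
pose c : R := n.*2.+2%:R^-1.
have c0 : 0 < c by rewrite invr_gt0 ltr0n.
apply: (@lt_le_trans _ _ (mu [set x | forall i, `[- c, c]%classic (tnth x i)])).
  by rewrite hmeasure_cube// lte_fin exprn_gt0// addr_gt0.
apply: le_measure; rewrite ?inE; [exact: measurable_cube|exact: measurable_hnorm_lt|].
move=> x h; rewrite /hball1/= hnorm_lt1.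
have sq i : hcoord x i ^+ 2 <= c ^+ 2.
  by have := h i; rewrite /= in_itv/= -ler_norml -real_normK ?num_real// ler_sqr ?nnegrE// ltW.
have c2 : c <= 2^-1.
  by rewrite lef_pV2 ?posrE ?ltr0n// ler_nat.
have nc : n.*2%:R * c <= 1.
  by rewrite ler_pdivrMr ?ltr0n// mul1r ler_nat 2?leqW.
set S := \sum_(i < _) _.
have S0 : 0 <= S by apply: sumr_ge0 => j _; exact: sqr_ge0.
have Sc : S <= c.
  apply: (@le_trans _ _ (\sum_(i < n.*2) c ^+ 2)); first by apply: ler_sum.
  rewrite sumr_const card_ord -mulr_natl expr2 mulrA.
  by rewrite ler_piMl// ltW.
have := sq ord_max; nra.
Qed.

(** In the notation of the theorem this real number is omega_Q / Q, not omega_Q. *)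
Definition omega1 : R := fine (Omega_Q R n).

Lemma omega1E : (omega1)%:E = Omega_Q R n.
Proof. by rewrite fineK// ge0_fin_numE ?Omega_Q_lty// ltW// Omega_Q_gt0. Qed.

Lemma omega1_gt0 : 0 < omega1.
Proof. by rewrite -lte_fin omega1E Omega_Q_gt0. Qed.

Lemma hmeasure_hrho_lt r : 0 <= r -> mu [set x | hrho x < r] = (r * omega1)%:E.
Proof.
have Q0 : Q%:R != 0 :> R by rewrite pnatr_eq0.
rewrite le_eqVlt => /predU1P[<-|r0].
  rewrite mul0r (_ : [set x | hrho x < 0] = set0) ?measure0//.
  by apply/seteqP; split => x //=; rewrite ltNge hrho_ge0.
have rQ : (r `^ Q%:R^-1) ^+ Q = r.
  by rewrite -powR_mulrn ?powR_ge0// -powRrM mulVf// powRr1// ltW.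
rewrite EFinM omega1E -{2}rQ -hmeasure_hnorm_lt ?powR_gt0//; congr (mu _).
have E x : (hrho x < r) = (hnorm x < r `^ Q%:R^-1).
  by rewrite /hrho -[in LHS]rQ ltr_pXn2r ?nnegrE ?powR_ge0 ?hnorm_ge0.
by apply/seteqP; split => x /=; rewrite E.
Qed.

Lemma measurable_hrho_set (A : set R) : measurable A -> measurable [set x : H | A (hrho x)].
Proof.
move=> mA; rewrite (_ : [set x : H | A (hrho x)] = setT `&` @hrho R n @^-1` A); last by rewrite setTI.
exact: measurable_hrho.
Qed.

Lemma measurable_hrho_lt r : measurable [set x : H | hrho x < r].
Proof.
have := @measurable_hrho_set `]-oo, r[%classic (measurable_itv _).
by congr measurable; apply/seteqP; split => x /=; rewrite in_itv.
Qed.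

Lemma measurable_hrho_le r : measurable [set x : H | hrho x <= r].
Proof.
have := @measurable_hrho_set `]-oo, r]%classic (measurable_itv _).
by congr measurable; apply/seteqP; split => x /=; rewrite in_itv.
Qed.

(** A closed sublevel set lies in every larger open one, and raising the level by e / omega1 raises
    the measure by e only. At level 0 this shows that the origin is null. *)
Lemma hmeasure_hrho_le r : 0 <= r -> mu [set x | hrho x <= r] = (r * omega1)%:E.
Proof.
move=> r0; apply/eqP; rewrite eq_le; apply/andP; split; last first.
  rewrite -hmeasure_hrho_lt//; apply: le_measure; rewrite ?inE.
  - exact: measurable_hrho_lt.
  - exact: measurable_hrho_le.
  - by move=> x /= /ltW.
apply/lee_addgt0Pr => e e0.
have O0 := omega1_gt0.
have re : r < r + e / omega1 by rewrite ltrDl divr_gt0.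
rewrite -EFinD (_ : r * omega1 + e = (r + e / omega1) * omega1); last first.
  by rewrite mulrDl divfK// gt_eqF.
rewrite -hmeasure_hrho_lt ?(le_trans r0) ?(ltW re)//; apply: le_measure; rewrite ?inE.
- exact: measurable_hrho_le.
- exact: measurable_hrho_lt.
- by move=> x /= /le_lt_trans; apply.
Qed.

Lemma hrho_null : mu [set x | hrho x = 0] = 0%E.
Proof.
rewrite -[RHS](_ : (0 * omega1)%:E = 0%E); last by rewrite mul0r.
rewrite -hmeasure_hrho_le//; congr (mu _).
apply/seteqP; split => x /= => [->//|h].
by apply/eqP; rewrite eq_le h hrho_ge0.
Qed.

Lemma hmeasure_hrho_oc (a b : R) : 0 <= a -> a <= b ->
  mu [set x | a < hrho x <= b] = ((b - a) * omega1)%:E.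
Proof.
move=> a0 ab.
have -> : [set x : H | a < hrho x <= b] = [set x | hrho x <= b] `\` [set x | hrho x <= a].
  apply/seteqP; split => x /=.
    by move=> /andP[ax xb]; split => //; apply/negP; rewrite -ltNge.
  by move=> [-> /negP]; rewrite -ltNge => ->.
have b0 := le_trans a0 ab.
have mule_b : mu [set x | hrho x <= b] = (b * omega1)%:E by exact: hmeasure_hrho_le.
have mule_a : mu ([set x | hrho x <= b] `&` [set x | hrho x <= a]) = (a * omega1)%:E.
  rewrite -hmeasure_hrho_le//; congr (mu _).
  by apply/seteqP; split => x /= => [[]//|h]; split => //; exact: le_trans ab.
apply: (etrans (@measureD _ _ _ mu _ _ (measurable_hrho_le b) (measurable_hrho_le a) _)).
  by apply: (@eq_ind_r _ _ (fun z : \bar R => (z < +oo)%E) (ltry _) _ mule_b).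
apply: (etrans (congr2 (fun u v : \bar R => u - v)%E mule_b mule_a)).
by rewrite mulrBl EFinB.
Qed.

(** The image of the measure under [hrho] and [omega1] times Lebesgue measure agree on half-open
    intervals, a generating family closed under intersection, hence on all measurable sets. Both are
    first restricted to the positive half-line, since Lebesgue measure also charges the negative
    one. *)
Lemma gauge_heisenberg : gauge mu (@hrho R n) omega1.
Proof.
split; [exact: measurable_hrho|exact: omega1_gt0|move=> g mg g0].
have mrho : measurable_fun setT (@hrho R n : H -> measurableTypeR R).
  exact: measurable_hrho.
pose nu : {measure set (measurableTypeR R) -> \bar R} :=
  measure_function_pushforward__canonical__measure_function_Measure mu mrho.
have mP : measurable (`]0, +oo[%classic : set (measurableTypeR R)) by exact: measurable_itv.
pose k := NngNum (ltW omega1_gt0).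
pose m1 : {measure set (measurableTypeR R) -> \bar R} := mrestr nu mP.
pose m2 : {measure set (measurableTypeR R) -> \bar R} := mscale k (mrestr leb mP).
have m12 (A : set (measurableTypeR R)) : measurable A -> m1 A = m2 A.
  have oc a b : m1 `]a, b]%classic = m2 `]a, b]%classic.
    have PE : `]a, b] `&` `]0, +oo[ = `]Num.max a 0, b]%classic.
      apply/seteqP; split => x /=; rewrite !in_itv/= andbT gt_max.
        by move=> [/andP[-> ->] ->].
      by move=> /andP[/andP[-> ->] ->].
    have -> : m1 `]a, b]%classic = mu [set x | (Num.max a 0 < hrho x <= b)%R].
      change (mu (@hrho R n @^-1` (`]a, b] `&` `]0, +oo[)) = mu [set x | (Num.max a 0 < hrho x <= b)%R]).
      by rewrite PE; congr (mu _); apply/seteqP; split => x /=; rewrite in_itv.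
    have -> : m2 `]a, b]%classic = (omega1%:E * leb `](Num.max a 0)%R, b]%classic)%E.
      by rewrite -PE.
    rewrite lebesgue_measure_itv/= lte_fin.
    have [ab|ba] := ltP (Num.max a 0) b.
      by rewrite -EFinM mulrC -hmeasure_hrho_oc ?(ltW ab)// le_max lexx orbT.
    rewrite mule0 (_ : [set x | _] = set0) ?measure0//.
    apply/seteqP; split => x //= /andP[h1 h2].
    by move: (lt_le_trans h1 h2); rewrite ltNge ba.
  apply: (@measure_unique _ R (measurableTypeR R) (@ocitv R) (fun k => `](- k%:R), k%:R]%classic)) => //.
  - exact: ocitvI.
  - by move=> i; exists (- i%:R, i%:R).
  - exact: bigcup_itvT.
  - by move=> _ [[a b]] _ <-.
  - move=> i; rewrite oc /m2 /mscale /= /mrestr.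
    rewrite lte_mul_pinfty ?lee_fin ?(ltW omega1_gt0)//.
    apply: (@le_lt_trans _ _ (leb `](- i%:R), i%:R]%classic)).
      by apply: le_measure; rewrite ?inE//; exact: measurableI.
    by rewrite lebesgue_measure_itv/=; case: ifP => _; rewrite ?ltry// -EFinB ltry.
transitivity (\int[nu]_(r in `]0%R, +oo[) g r)%E.
  rewrite (ge0_integral_pushforward mrho)//; last exact: measurable_funTS.
  congr integral; apply/seteqP; split => x /=; by rewrite in_itv/= andbT.
rewrite -(ge0_integral_mscale leb mP k)//; last exact: measurable_funTS.
apply: eq_measure_integral => A mA AP; have := m12 A mA.
change (nu (A `&` `]0, +oo[) = (omega1%:E * leb (A `&` `]0%R, +oo[))%E ->
  nu A = (omega1%:E * leb A)%E).
by rewrite (setIidl AP).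
Qed.

End heisenberg_gauge.

(** * Finite products of real powers *)

Section powR_products.
Variable R : realType.

Lemma prod_powR_exponents (m : nat) (x : R) (e : 'I_m -> R) : 0 < x ->
  \prod_(j < m) x `^ e j = x `^ (\sum_(j < m) e j).
Proof.
move=> x0; rewrite [RHS]/powR gt_eqF// mulr_suml expR_sum.
by apply: eq_bigr => j _; rewrite /powR gt_eqF.
Qed.

Lemma prod_powR (m : nat) (x : 'I_m -> R) (e : R) : (forall j, 0 <= x j) ->
  \prod_(j < m) x j `^ e = (\prod_(j < m) x j) `^ e.
Proof.
move=> x0; suff [] : \prod_(j < m) x j `^ e = (\prod_(j < m) x j) `^ e /\
  0 <= \prod_(j < m) x j by [].
elim/big_rec2 : _ => [|j u v _ [-> v0]]; first by rewrite powR1.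
by rewrite powRM ?mulr_ge0.
Qed.

End powR_products.

(** * The upper bound over an abstract gauge *)

Section multilinear.
Context d (T : measurableType d) (R : realType).
Variables (mu : {sigma_finite_measure set T -> \bar R}) (rho : T -> R) (O : R).
Hypotheses (grho : gauge mu rho O) (rho_ge0 : forall x, 0 <= rho x).
Hypothesis rho_null : mu [set x | rho x = 0] = 0%E.
Local Notation D := [set x | (0 < rho x)%R].
Local Notation leb := (@lebesgue_measure R).

(** Despite its name this is the whole operator applied to f; for rho = [hrho] it is convertible to
    [hilbert3], see [hilbert3E]. *)
Definition multilinear_kernel (m : nat) (f : 'I_m -> T -> R) (x : T) : \bar R :=
  (\int[pow_measure mu m]_y
    ((\prod_(j < m) f j (tnth y j)) / (rho x + \sum_(j < m) rho (tnth y j)) ^+ m)%:E)%E.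

Section upper_bound.
Variables (m : nat) (q b : R) (qs a n : 'I_m -> R) (f : 'I_m -> T -> R).
Hypotheses (m0 : (0 < m)%N) (q1 : 1 < q) (qs1 : forall j, 1 < qs j).
Hypothesis qE : \sum_(j < m) (qs j)^-1 = q^-1.
Hypotheses (b0 : 0 < b) (a0 : forall j, 0 < a j).
Hypothesis abE : b + \sum_(j < m) a j = m%:R.
Hypotheses (mf : forall j, measurable_fun setT (f j)) (f0 : forall j x, 0 <= f j x).
Hypothesis n0 : forall j, 0 < n j.
Hypothesis fn : forall j, (\int[mu]_(x in D)
  (f j x `^ qs j * rho x `^ (qs j * (1 - a j) - 1))%:E <= (n j)%:E)%E.

Let powR_assembly (o gm gb P N : R) : 0 < o -> 0 < gm -> 0 < gb -> 0 <= P ->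
  gm^-1 `^ q * (o * gb `^ q * (o `^ (q * m%:R - 1) * P `^ q * N)) =
  (o ^+ m * gb * P / gm) `^ q * N.
Proof.
move=> o0 gm0 gb0 P0.
rewrite [in RHS]powRM ?mulr_ge0 ?invr_ge0 ?exprn_ge0 ?(ltW o0) ?(ltW gb0) ?(ltW gm0)//.
rewrite powRM ?mulr_ge0 ?exprn_ge0 ?(ltW o0) ?(ltW gb0)//.
rewrite powRM ?exprn_ge0 ?(ltW o0) ?(ltW gb0)// -(powR_mulrn _ (ltW o0)) -powRrM.
have -> : o `^ (m%:R * q) = o `^ (q * m%:R - 1) * o.
  rewrite -[X in _ = _ * X](powRr1 (ltW o0)) -powRD ?(gt_eqF o0) ?implybT//.
  by congr powR; ring.
by ring.
Qed.

(** The transforms are made real-valued because [laplace] accepts only real functions, and [G] is to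
    be transformed again. By [laplaceE] nothing is lost for s > 0. *)
Let F j s : R := fine (laplace mu rho (f j) s).
Let G s : R := s `^ (m%:R - 1) * \prod_(j < m) F j s.

Let laplaceE j s : 0 < s -> laplace mu rho (f j) s = (F j s)%:E.
Proof.
move=> s0; rewrite fineK// ge0_fin_numE ?laplace_ge0//.
apply: (laplace_lty grho (mf j) (f0 j) (qs1 j) (a0 j) s0).
by apply: le_lt_trans (fn j) _; exact: ltry.
Qed.

Let F_ge0 j s : 0 <= F j s.
Proof. by apply: fine_ge0; exact: laplace_ge0. Qed.

Let G_ge0 s : 0 <= G s.
Proof. by rewrite mulr_ge0 ?powR_ge0// prodr_ge0. Qed.

Let mF j : measurable_fun setT (F j : measurableTypeR R -> R).
Proof.
apply: measurableT_comp => //.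
exact: (measurable_laplace_gauge grho (@gauge_half_line R) (mf j) (f0 j)).
Qed.

Let mG : measurable_fun setT (G : measurableTypeR R -> R).
Proof.
apply: measurable_funM; first exact: measurable_powR.
exact: measurable_bigprod.
Qed.

Let kernelE x : D x -> multilinear_kernel f x =
  ((Gamma m%:R)^-1%:E * laplace leb (fun s : measurableTypeR R => s : R) G (rho x))%E.
Proof.
move=> x0; rewrite /multilinear_kernel.
rewrite (multilinear_kernelE grho rho_ge0 rho_null m0 x0 mf f0); congr (_ * _)%E.
rewrite [laplace leb _ _ _]/laplace (_ : [set s : R | 0 < s] = `]0, +oo[%classic); last first.
  by apply/seteqP; split => s /=; rewrite in_itv/= andbT.
apply: eq_integral => s; rewrite inE/= in_itv/= andbT => s0.
under eq_bigr do rewrite laplaceE//.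
by rewrite prodEFin -EFinM /G (mulrC s) mulrAC.
Qed.

Let q0 : 0 < q. Proof. exact: lt_trans q1. Qed.
Let qs0 j : 0 < qs j. Proof. exact: lt_trans (qs1 j). Qed.

Let theta_sum : \sum_(j < m) q / qs j = 1.
Proof. by rewrite -mulr_sumr qE divff// gt_eqF. Qed.

(** The identity b + sum a_j = m enters here: the exponent of s is q (m - b) - 1 on the left and q
    sum a_j - 1 on the right. The right side has the form required by Hoelder's inequality with
    weights q / q_j. *)
Let GE s : 0 < s -> G s `^ q * s `^ (q * (1 - b) - 1) =
  \prod_(j < m) (F j s `^ qs j * s `^ (qs j * a j - 1)) `^ (q / qs j).
Proof.
move=> s0; under eq_bigr => j _.
  rewrite powRM ?powR_ge0// -!powRrM mulrCA divff ?gt_eqF// mulr1.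
  rewrite (_ : (qs j * a j - 1) * (q / qs j) = q * a j - q / qs j); last first.
    by field; rewrite gt_eqF.
  over.
rewrite big_split/= prod_powR// prod_powR_exponents// sumrB theta_sum -mulr_sumr.
rewrite /G powRM ?powR_ge0 ?prodr_ge0// -powRrM mulrAC -powRD ?(gt_eqF s0) ?implybT//.
rewrite mulrC; congr (_ * _ `^ _).
by rewrite -[m%:R in LHS]abE; ring.
Qed.

Lemma multilinear_kernel_upper :
  (\int[mu]_(x in D) (multilinear_kernel f x `^ q * (rho x `^ (q * b - 1))%:E) <=
   ((O ^+ m * Gamma b * (\prod_(j < m) Gamma (a j)) / Gamma m%:R) `^ q *
    \prod_(j < m) n j `^ (q / qs j))%:E)%E.
Proof.
have mD := measurable_gauge_gt0 grho; have O0 := gauge_gt0 grho.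
have Gm : 0 < Gamma m%:R :> R by apply: Gamma_gt0; rewrite ltr0n.
have Gb := Gamma_gt0 b0; have Ga j := Gamma_gt0 (a0 j).
have mL : measurable_fun setT (fun x => laplace leb (fun s : measurableTypeR R => s : R) G (rho x)).
  exact: (measurable_laplace_gauge (@gauge_half_line R) grho mG G_ge0).
pose L x := laplace leb (fun s : measurableTypeR R => s : R) G (rho x).
have L0 x : (0 <= L x)%E by exact: laplace_ge0.
have mLq : measurable_fun setT (fun x => L x `^ q * (rho x `^ (q * b - 1))%:E)%E.
  apply: emeasurable_funM; first exact: (measurableT_comp (measurable_poweR q)).
  by apply/measurable_EFinP; apply: measurable_powR_comp; exact: measurable_gauge grho.
have -> : (\int[mu]_(x in D) (multilinear_kernel f x `^ q * (rho x `^ (q * b - 1))%:E) =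
    \int[mu]_(x in D) (((Gamma m%:R)^-1 `^ q)%:E * (L x `^ q * (rho x `^ (q * b - 1))%:E)))%E.
  apply: eq_integral => x; rewrite inE => /kernelE ->.
  by rewrite poweRM ?L0 ?lee_fin ?invr_ge0 ?(ltW Gm)// muleA.
rewrite ge0_integralZl_EFin ?powR_ge0//; last 2 first.
- by move=> x _; rewrite mule_ge0 ?poweR_ge0 ?lee_fin ?powR_ge0.
- exact: measurable_funTS.
(* These are the Schur bounds for the F_j, the factor 1 being the gauge constant of the half-line.
   The existential keeps c opaque until its formula is wanted. *)
have [c cdef] : exists c : 'I_m -> R, forall j,
    c j = O `^ (qs j - 1) * 1 * Gamma (a j) `^ qs j * n j by eexists.
have c0 j : 0 < c j.
  rewrite cdef; apply: mulr_gt0 (n0 j); rewrite mulr1.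
  by apply: mulr_gt0; exact: powR_gt0.
have mFq j : measurable_fun setT (fun s : measurableTypeR R =>
    F j s `^ qs j * s `^ (qs j * a j - 1)).
  by apply: measurable_funM; [exact: measurable_powR_comp|exact: measurable_powR].
have Rpos : [set s : R | 0 < s] = `]0, +oo[%classic.
  by apply/seteqP; split => s /=; rewrite in_itv/= andbT.
have Fc j : (\int[leb]_(s in `]0%R, +oo[)
    (F j s `^ qs j * s `^ (qs j * a j - 1))%:E <= (c j)%:E)%E.
  have := laplace_bound grho (@gauge_half_line R) (mf j) (f0 j) (qs1 j) (a0 j).
  rewrite Rpos => H; apply: le_trans (le_trans H _).
    rewrite le_eqVlt; apply/orP; left; apply/eqP; apply: eq_integral => s.
    by rewrite inE/= in_itv/= andbT => s0; rewrite laplaceE.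
  rewrite cdef [in leRHS]EFinM; apply: lee_wpmul2l => //.
  by rewrite lee_fin !mulr_ge0 ?powR_ge0.
have := laplace_bound (@gauge_half_line R) grho mG G_ge0 q1 b0.
have -> : (\int[leb]_(s in [set s | (0 < s)%R]) (G s `^ q * s `^ (q * (1 - b) - 1))%:E =
    \int[leb]_(s in `]0%R, +oo[)
      (\prod_(j < m) (F j s `^ qs j * s `^ (qs j * a j - 1)) `^ (q / qs j))%:E)%E.
  rewrite Rpos; apply: eq_integral => s; rewrite inE/= in_itv/= andbT => s0.
  by rewrite GE.
have Hol := ge0_integral_prod_powR_le (mu := leb) (D := `]0, +oo[%classic) (measurable_itv _) mFq
  (fun j s _ => mulr_ge0 (powR_ge0 _ _) (powR_ge0 _ _))
  (fun j => divr_gt0 q0 (qs0 j)) theta_sum c0 Fc.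
move=> Lb; have {Lb Hol} := le_trans Lb (lee_wpmul2l _ Hol).
rewrite lee_fin !mulr_ge0 ?powR_ge0 ?(ltW O0)// => /(_ isT) Lb.
apply: (le_trans (lee_wpmul2l _ Lb)); first by rewrite lee_fin powR_ge0.
rewrite -!EFinM lee_fin le_eqVlt; apply/orP; left; apply/eqP.
(* Each O^(q_j - 1) is raised to q / q_j, giving the exponent q - q / q_j; the sum over j is q m -
   1. The missing factor O comes from the second transform. *)
have cE : \prod_(j < m) c j `^ (q / qs j) =
    O `^ (q * m%:R - 1) * (\prod_(j < m) Gamma (a j)) `^ q * \prod_(j < m) n j `^ (q / qs j).
  rewrite -(prod_powR q (fun j => ltW (Ga j))).
  rewrite (_ : q * m%:R - 1 = \sum_(j < m) (q - q / qs j)); last first.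
    by rewrite sumrB theta_sum sumr_const card_ord mulr_natr.
  rewrite -prod_powR_exponents// -!big_split/=; apply: eq_bigr => j _.
  rewrite cdef mulr1 !powRM ?mulr_ge0 ?powR_ge0 ?(ltW (n0 j))// -!powRrM.
  congr (_ `^ _ * _ `^ _ * _); first by field; rewrite gt_eqF.
  by rewrite mulrCA divff ?mulr1// gt_eqF.
rewrite cE powR1 mul1r; apply: (powR_assembly _ O0 Gm Gb).
by apply: prodr_ge0 => j _; exact: ltW (Ga j).
Qed.

End upper_bound.
End multilinear.

(** * Truncated Gamma integrals *)

Section window_gamma.
Context {R : realType}.
Implicit Types (a s x : R).
Local Notation leb := (@lebesgue_measure R).

(** What remains of the Gamma integral when the product of the two Laplace variables is confined to
    a window, as in the lower bound. *)
Definition window_gamma k a : R :=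
  fine (\int[leb]_(x in window k) (x `^ (a - 1) * expR (- (1 * x)))%:E)%E.

Let mgE a c : measurable_fun setT (fun x : R => (x `^ (a - 1) * expR (- (c * x)))%:E).
Proof. by apply/measurable_EFinP; exact: measurable_gamma_integrand. Qed.

Let gE0 a c x : (0 <= (x `^ (a - 1) * expR (- (c * x)))%:E)%E.
Proof. by rewrite lee_fin mulr_ge0 ?powR_ge0 ?expR_ge0. Qed.

Lemma measurable_window k : measurable (window k : set (measurableTypeR R)).
Proof. exact: measurable_itv. Qed.

Lemma window_gamma_ge0 k a : 0 <= window_gamma k a.
Proof. by apply: fine_ge0; apply: integral_ge0. Qed.

Lemma window_gammaE k a : 0 < a -> (window_gamma k a)%:E =
  (\int[leb]_(x in window k) (x `^ (a - 1) * expR (- (1 * x)))%:E)%E.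
Proof.
move=> a0; rewrite fineK// ge0_fin_numE; last exact: integral_ge0.
apply: (le_lt_trans _ (gamma_integral_lty a0)).
apply: ge0_subset_integral => //; first exact: measurable_window.
- by apply: measurable_funTS; exact: mgE.
- by rewrite -window_bigcup; exact: bigcup_sup.
Qed.

Lemma cvg_window_gamma a : 0 < a -> window_gamma k a @[k --> \oo] --> Gamma a.
Proof.
move=> a0; apply: fine_cvg.
have -> : (Gamma a)%:E = (\int[leb]_(x in `]0%R, +oo[) (x `^ (a - 1) * expR (- (1 * x)))%:E)%E.
  by rewrite gamma_integralE// powR1 mul1r.
exact: cvg_integral_window.
Qed.

Lemma measurable_scaled_window k s :
  measurable ( *%R s @^-1` (window k) : set (measurableTypeR R)).
Proof.
rewrite -[X in measurable X]setTI.
by apply: (mulrl_measurable s) => //; exact: measurable_window.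
Qed.

Lemma integral_scaled_window k a s : 0 < a -> 0 < s ->
  (\int[leb]_(x in *%R s @^-1` (window k)) (x `^ (a - 1) * expR (- (s * x)))%:E =
   (s `^ (- a) * window_gamma k a)%:E)%E.
Proof.
move=> a0 s0.
rewrite (_ : s `^ (- a) = s `^ (1 - a) * s^-1); last first.
  rewrite powRD ?(gt_eqF s0) ?implybT// powRr1 ?ltW//.
  by rewrite mulrAC divff ?mul1r// gt_eqF.
rewrite EFinM window_gammaE// [in RHS]EFinM -muleA.
rewrite -(ge0_integral_lebesgue_scale s0 (measurable_window k))//; last first.
  by apply: measurable_funTS; exact: mgE.
rewrite -ge0_integralZl_EFin ?powR_ge0//; last 2 first.
- exact: measurable_scaled_window.
- apply: measurable_funTS.
  exact: (measurableT_comp (mgE a 1) (mulrl_measurable s)).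
apply: eq_integral => x; rewrite inE /window/= in_itv/= => /andP[sx _].
have x0 : 0 < x.
  by rewrite -(pmulr_rgt0 _ s0); apply: lt_le_trans sx; rewrite invr_gt0.
rewrite -EFinM mul1r; congr EFin.
rewrite powRM ?ltW// !mulrA -powRD ?(gt_eqF s0) ?implybT//.
by rewrite (_ : 1 - a + (a - 1) = 0) ?powRr0 ?mul1r//; ring.
Qed.

End window_gamma.

(** * Test functions and their Laplace transforms *)

Section lower_bound.
Context d (T : measurableType d) (R : realType).
Variables (mu : {sigma_finite_measure set T -> \bar R}) (rho : T -> R) (O : R).
Hypotheses (grho : gauge mu rho O) (rho_ge0 : forall x, 0 <= rho x).
Hypothesis rho_null : mu [set x | rho x = 0] = 0%E.
Local Notation D := [set x | (0 < rho x)%R].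
Local Notation leb := (@lebesgue_measure R).
Implicit Types (a c e s r p : R).

(** For the exponents used, the weighted power in the norm is r^(-e-1): integrable at infinity but
    not at 0, whence the cut at 1. *)
Definition tail_power c r : R := r `^ c * \1_(`]1, +oo[%classic) r.

Lemma tail_power_ge0 c r : 0 <= tail_power c r.
Proof. by rewrite mulr_ge0 ?powR_ge0. Qed.

Lemma measurable_tail_power c : measurable_fun setT (tail_power c).
Proof. by apply: measurable_funM => //; exact: measurable_powR. Qed.

Lemma integral_tail_power a e p K : 0 < p ->
  (\int[leb]_(r in `]1%R, +oo[) (r `^ (- e - 1))%:E = K%:E)%E ->
  (\int[mu]_(x in D) (tail_power (a - 1 - e / p) (rho x) `^ p *
     rho x `^ (p * (1 - a) - 1))%:E = (O * K)%:E)%E.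
Proof.
move=> p0 KE; have [_ _ polar] := grho.
rewrite (polar (fun r => (tail_power (a - 1 - e / p) r `^ p * r `^ (p * (1 - a) - 1))%:E)); last 2 first.
- apply/measurable_EFinP; apply: measurable_funM; last exact: measurable_powR.
  by apply: measurable_powR_comp; exact: measurable_tail_power.
- by move=> r; rewrite lee_fin mulr_ge0 ?powR_ge0.
rewrite EFinM -KE; congr (_ * _)%E.
rewrite integral_mkcond [RHS]integral_mkcond; apply: eq_integral => r _.
rewrite !patchE /tail_power indicE.
have [r1|r1] := boolP (r \in (`]1, +oo[%classic : set R)); last first.
  by rewrite mulr0 powR0 ?gt_eqF// mul0r if_same.
move: r1; rewrite inE/= in_itv/= andbT => r1; have r0 := lt_trans ltr01 r1.
rewrite ifT; last by rewrite inE/= in_itv/= andbT.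
rewrite mulr1 -powRrM -powRD ?(gt_eqF r0) ?implybT//; congr ((_ `^ _)%:E).
by field; rewrite gt_eqF.
Qed.

(** If s r lies in the window and (k+1) s < 1, then r >= 1 / ((k+1) s) > 1, so the cut is invisible.
    Moreover r <= (k+1) / s, which bounds the perturbation r^(-e/p) below by (s / (k+1))^(e/p). *)
Lemma laplace_tail_power_ge k a e p s : 0 < a -> 0 <= e -> 0 < p -> 0 < s ->
  k.+1%:R * s < 1 ->
  ((O * window_gamma k a * s `^ (- a) * (s / k.+1%:R) `^ (e / p))%:E <=
   laplace mu rho (fun x => tail_power (a - 1 - e / p) (rho x)) s)%E.
Proof.
move=> a0 e0 p0 s0 Ls; have [_ O0 polar] := grho.
have L0 : 0 < k.+1%:R :> R by [].
have mphi c : measurable_fun setT (fun r : R => (tail_power c r * expR (- (s * r)))%:E).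
  apply/measurable_EFinP; apply: measurable_funM; first exact: measurable_tail_power.
  by apply: measurableT_comp => //; apply: measurableT_comp.
rewrite /laplace (polar (fun r => (tail_power (a - 1 - e / p) r * expR (- (s * r)))%:E))//; last first.
  by move=> r; rewrite lee_fin mulr_ge0 ?tail_power_ge0 ?expR_ge0.
rewrite -!mulrA EFinM; apply: lee_wpmul2l; first by rewrite lee_fin ltW.
set W := *%R s @^-1` (window k : set R).
apply: (@le_trans _ _ (\int[leb]_(r in W) (tail_power (a - 1 - e / p) r * expR (- (s * r)))%:E)%E); last first.
  apply: ge0_subset_integral => //.
  - exact: measurable_scaled_window.
  - by apply: measurable_funTS; first [exact: mphi|exact: mg].
  - by move=> r _; rewrite lee_fin mulr_ge0 ?tail_power_ge0 ?expR_ge0.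
  - move=> r; rewrite /W /window/= !in_itv/= andbT => /andP[sx _].
    by rewrite -(pmulr_rgt0 _ s0); apply: lt_le_trans sx; rewrite invr_gt0.
rewrite (_ : window_gamma k a * _ =
  (s / k.+1%:R) `^ (e / p) * (s `^ (- a) * window_gamma k a)); last by ring.
have mg : measurable_fun setT (fun r : R => (r `^ (a - 1) * expR (- (s * r)))%:E).
  by apply/measurable_EFinP; exact: measurable_gamma_integrand.
have -> : (((s / k.+1%:R) `^ (e / p) * (s `^ (- a) * window_gamma k a))%:E =
   \int[leb]_(r in W) (((s / k.+1%:R) `^ (e / p))%:E * (r `^ (a - 1) * expR (- (s * r)))%:E))%E.
  rewrite ge0_integralZl_EFin ?powR_ge0//.
  - by rewrite integral_scaled_window.
  - exact: measurable_scaled_window.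
  - by move=> r _; rewrite lee_fin mulr_ge0 ?powR_ge0 ?expR_ge0.
  - by apply: measurable_funTS; first [exact: mphi|exact: mg].
apply: ge0_le_integral => //.
- exact: measurable_scaled_window.
- by move=> r _; rewrite mule_ge0 ?lee_fin ?mulr_ge0 ?powR_ge0 ?expR_ge0.
- by apply: emeasurable_funM => //; apply: measurable_funTS; exact: mg.
- by apply: measurable_funTS; exact: mphi.
move=> r; rewrite /W /window/= in_itv/= => /andP[sx xs].
have r0 : 0 < r.
  by rewrite -(pmulr_rgt0 _ s0); apply: lt_le_trans sx; rewrite invr_gt0.
have r1 : 1 < r.
  rewrite -(ltr_pM2l (mulr_gt0 L0 s0)) mulr1 (lt_le_trans Ls)// -mulrA.
  by rewrite -ler_pdivrMl// mulr1.
rewrite -EFinM lee_fin mulrA ler_wpM2r ?expR_ge0// /tail_power indicE.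
rewrite mem_set ?mulr1; last by rewrite /= in_itv/= r1.
rewrite [leRHS]powRD ?(gt_eqF r0) ?implybT// [leRHS]mulrC ler_wpM2r ?powR_ge0//.
have -> : r `^ (- (e / p)) = r^-1 `^ (e / p).
  by rewrite -[r^-1](powR_inv1 (ltW r0)) -powRrM mulN1r.
apply: ge0_ler_powR; rewrite ?nnegrE ?invr_ge0 ?(ltW r0)//.
- by rewrite divr_ge0// ltW.
- by rewrite divr_ge0// ltW.
by rewrite -[r^-1]mul1r ler_pdivlMr// mulrAC ler_pdivrMr// mul1r.
Qed.

End lower_bound.

(** * Measurability of parametrized integrals *)

Section kernel_measurability.
Context d1 d2 (T1 : measurableType d1) (T2 : measurableType d2) (R : realType).
Variable m2 : {sigma_finite_measure set T2 -> \bar R}.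

(** The functions in the supremum may change sign, so Tonelli's theorem is applied to the positive
    and negative parts separately. *)
Lemma measurable_fun_integral_signed (g : T1 * T2 -> \bar R) :
  measurable_fun setT g -> measurable_fun setT (fun x => \int[m2]_y g (x, y))%E.
Proof.
move=> mg; under eq_fun do rewrite integralE.
apply: emeasurable_funB.
  have := measurable_fun_integral_in (f := (g^\+)%E) m2 measurableT (measurable_funepos mg)
    (fun z => funepos_ge0 g z).
  by congr measurable_fun; apply/funext => x; apply: eq_integral => y _; rewrite !funeposE.
have := measurable_fun_integral_in (f := (g^\-)%E) m2 measurableT (measurable_funeneg mg)
  (fun z => funeneg_ge0 g z).
by congr measurable_fun; apply/funext => x; apply: eq_integral => y _; rewrite !funenegE.
Qed.

Lemma emeasurable_bigprod (I : Type) (s : seq I) (F : I -> T1 -> \bar R) :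
  (forall i, measurable_fun setT (F i)) ->
  measurable_fun setT (fun x => \prod_(i <- s) F i x)%E.
Proof.
move=> mF; elim: s => [|i s IH].
  by under eq_fun do rewrite big_nil; exact: measurable_cst.
by under eq_fun do rewrite big_cons; exact: emeasurable_funM.
Qed.

Lemma lee_bigprod (m : nat) (x y : 'I_m -> \bar R) :
  (forall j, 0 <= x j)%E -> (forall j, x j <= y j)%E ->
  (\prod_(j < m) x j <= \prod_(j < m) y j)%E.
Proof.
move=> x0 xy; suff [] : (\prod_(j < m) x j <= \prod_(j < m) y j)%E /\
  (0 <= \prod_(j < m) x j)%E by [].
elim/big_rec2 : _ => [|j u v _ [uv u0]]; first by [].
by split; [exact: lee_pmul|exact: mule_ge0].
Qed.

End kernel_measurability.

(** * The lower bound over an abstract gauge *)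

Section kernel_lower.
Context d (T : measurableType d) (R : realType).
Variables (mu : {sigma_finite_measure set T -> \bar R}) (rho : T -> R) (O : R).
Hypotheses (grho : gauge mu rho O) (rho_ge0 : forall x, 0 <= rho x).
Hypothesis rho_null : mu [set x | rho x = 0] = 0%E.
Local Notation D := [set x | (0 < rho x)%R].
Local Notation leb := (@lebesgue_measure R).

Lemma measurable_multilinear_kernel (m : nat) (f : 'I_m -> T -> R) :
  (forall j, measurable_fun setT (f j)) ->
  measurable_fun setT (multilinear_kernel mu rho f).
Proof.
move=> mf.
pose S (z : T * m.-tuple T) := rho z.1 + \sum_(j < m) rho (tnth z.2 j).
have mt j : measurable_fun setT (fun z : T * m.-tuple T => tnth z.2 j).
  exact: measurableT_comp (measurable_tnth j) measurable_snd.
have mrho := measurable_gauge grho.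
have mS : measurable_fun setT S.
  apply: measurable_funD; first exact: measurableT_comp mrho measurable_fst.
  by apply: measurable_bigsum => j; exact: measurableT_comp mrho (mt j).
apply: (measurable_fun_integral_signed (pow_measure mu m)
  (g := fun z => ((\prod_(j < m) f j (tnth z.2 j)) / S z ^+ m)%:E)).
apply/measurable_EFinP; apply: measurable_funM.
  by apply: measurable_bigprod => j; exact: measurableT_comp (mf j) (mt j).
have -> : (fun z => (S z ^+ m)^-1) = (fun z => S z `^ (- m%:R)).
  by apply/funext => z; rewrite powR_invn// addr_ge0// sumr_ge0.
exact: measurable_powR_comp.
Qed.

Variables (m k : nat) (q b e : R) (qs a : 'I_m -> R).
Hypotheses (m0 : (0 < m)%N) (q1 : 1 < q) (qs1 : forall j, 1 < qs j).
Hypothesis qE : \sum_(j < m) (qs j)^-1 = q^-1.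
Hypotheses (b0 : 0 < b) (a0 : forall j, 0 < a j).
Hypothesis abE : b + \sum_(j < m) a j = m%:R.
Hypothesis e0 : 0 < e.

Let L : R := k.+1%:R.
Let f j x : R := tail_power (a j - 1 - e / qs j) (rho x).
Let L0 : 0 < L. Proof. by []. Qed.

Let mf j : measurable_fun setT (f j).
Proof. exact: measurableT_comp (measurable_tail_power _) (measurable_gauge grho). Qed.

Let f0 j x : 0 <= f j x. Proof. exact: tail_power_ge0. Qed.

Let P := \prod_(j < m) window_gamma k (a j).
Let P0 : 0 <= P. Proof. by apply: prodr_ge0 => j _; exact: window_gamma_ge0. Qed.

(** Restrict the s-integral to s rho(x) in [1/L, L]. Then s <= L / rho(x) < 1 / L, so
    [laplace_tail_power_ge] applies to every factor, while s / L >= 1 / (L^2 rho(x)) makes the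
    perturbations independent of s. The remaining power of s is m - 1 - sum a_j = b - 1. *)
Lemma multilinear_kernel_ge x : L * L < rho x ->
  (((Gamma m%:R)^-1 * (O ^+ m * P * (L * L * rho x)^-1 `^ (e / q)) *
    (rho x `^ (- b) * window_gamma k b))%:E <= multilinear_kernel mu rho f x)%E.
Proof.
move=> Lx; have LL0 : 0 < L * L by rewrite mulr_gt0.
have x0 : 0 < rho x by exact: lt_trans Lx.
have O0 := gauge_gt0 grho.
have Gm : 0 < Gamma m%:R :> R by apply: Gamma_gt0; rewrite ltr0n.
rewrite /multilinear_kernel (multilinear_kernelE grho rho_ge0 rho_null m0 x0 mf f0).
rewrite -mulrA EFinM; apply: lee_wpmul2l; first by rewrite lee_fin invr_ge0 ltW.
set W := ( *%R (rho x) @^-1` (window k : set R)).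
have mW : measurable W by exact: measurable_scaled_window.
pose h s : \bar R := ((s `^ (m%:R - 1) * expR (- (s * rho x)))%:E *
  \prod_(j < m) laplace mu rho (f j) s)%E.
have h0 s : (0 <= h s)%E.
  apply: mule_ge0; first by rewrite lee_fin mulr_ge0 ?powR_ge0 ?expR_ge0.
  by apply: prode_ge0 => j _; exact: laplace_ge0.
have mh : measurable_fun setT h.
  apply: emeasurable_funM.
    apply/measurable_EFinP; apply: measurable_funM; first exact: measurable_powR.
    apply: measurableT_comp => //; apply: measurableT_comp => //.
    exact: measurable_funM.
  apply: emeasurable_bigprod => j.
  exact: (measurable_laplace_gauge grho (@gauge_half_line R) (mf j) (f0 j)).
apply: (@le_trans _ _ (\int[leb]_(s in W) h s)%E); last first.
  apply: ge0_subset_integral => //; first by apply: measurable_funTS.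
  move=> s; rewrite /W /window/= !in_itv/= andbT => /andP[sx _].
  by rewrite -(pmulr_rgt0 _ x0); apply: lt_le_trans sx; rewrite invr_gt0.
pose C := O ^+ m * P * (L * L * rho x)^-1 `^ (e / q).
have C0 : 0 <= C by rewrite !mulr_ge0 ?powR_ge0 ?exprn_ge0 ?(ltW O0).
have mg : measurable_fun setT (fun s : R => (s `^ (b - 1) * expR (- (rho x * s)))%:E).
  by apply/measurable_EFinP; exact: measurable_gamma_integrand.
have -> : (((O ^+ m * P * (L * L * rho x)^-1 `^ (e / q)) * (rho x `^ (- b) * window_gamma k b))%:E
  = \int[leb]_(s in W) (C%:E * (s `^ (b - 1) * expR (- (rho x * s)))%:E))%E.
  rewrite ge0_integralZl_EFin//.
  - by rewrite integral_scaled_window.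
  - by move=> r _; rewrite lee_fin mulr_ge0 ?powR_ge0 ?expR_ge0.
  - by apply: measurable_funTS; exact: mg.
apply: ge0_le_integral => //.
- by move=> s _; apply: mule_ge0; rewrite lee_fin// mulr_ge0 ?powR_ge0 ?expR_ge0.
- by apply: emeasurable_funM => //; apply: measurable_funTS; exact: mg.
- by apply: measurable_funTS.
move=> s; rewrite /W /window/= in_itv/= -/L => /andP[sx xs].
have s0 : 0 < s.
  by rewrite -(pmulr_rgt0 _ x0); apply: lt_le_trans sx; rewrite invr_gt0.
have Ls : L * s < 1.
  rewrite -(ltr_pM2l x0) mulr1 mulrCA (le_lt_trans _ Lx)// ler_wpM2l// ltW//.
have cs : (L * L * rho x)^-1 <= s / L.
  rewrite ler_pdivlMr// -(ler_pM2l x0) (le_trans _ sx)//.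
  by rewrite le_eqVlt; apply/orP; left; apply/eqP; field; rewrite !gt_eqF.
pose c j := O * window_gamma k (a j) * s `^ (- a j) * (L * L * rho x)^-1 `^ (e / qs j).
have c0 j : 0 <= c j by rewrite !mulr_ge0 ?powR_ge0 ?window_gamma_ge0 ?(ltW O0).
have qs0 j : 0 < qs j by exact: lt_trans (qs1 j).
have clap j : ((c j)%:E <= laplace mu rho (f j) s)%E.
  apply: (le_trans _ (laplace_tail_power_ge grho (a0 j) (ltW e0) (qs0 j) s0 Ls)).
  rewrite lee_fin ler_wpM2l ?mulr_ge0 ?powR_ge0 ?window_gamma_ge0 ?(ltW O0)//.
  apply: ge0_ler_powR; rewrite ?nnegrE ?divr_ge0 ?invr_ge0 ?mulr_ge0 ?(ltW L0) ?(ltW e0) ?(ltW (qs0 j)) ?(ltW s0) ?(ltW x0)//.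
apply: (@le_trans _ _ ((s `^ (m%:R - 1) * expR (- (s * rho x)))%:E * \prod_(j < m) (c j)%:E)%E); last first.
  apply: lee_wpmul2l; first by rewrite lee_fin mulr_ge0 ?powR_ge0 ?expR_ge0.
  by apply: lee_bigprod => j; rewrite ?lee_fin.
rewrite prodEFin -!EFinM lee_fin le_eqVlt; apply/orP; left; apply/eqP.
rewrite !big_split/= prodr_const card_ord -/P prod_powR_exponents// prod_powR_exponents; last first.
  by rewrite invr_gt0 mulr_gt0.
rewrite -mulr_sumr qE sumrN (mulrC s (rho x)).
rewrite (_ : b - 1 = (m%:R - 1) + - \sum_(j < m) a j); last by rewrite -abE; ring.
by rewrite [in LHS]powRD ?(gt_eqF s0) ?implybT// /C; ring.
Qed.

(** The loss (L^2)^(-2e) has two equal sources: the q-th power of the pointwise bound, and the tail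
    integral, which starts at M = L^2 instead of 1. *)
Lemma multilinear_kernel_lower (K : R) :
  (forall M : R, 0 < M ->
    (\int[leb]_(r in `]M, +oo[) (r `^ (- e - 1))%:E)%E = (M `^ (- e) * K)%:E) ->
  (((O ^+ m * P * window_gamma k b / Gamma m%:R) `^ q * (L * L) `^ (- (e + e)) * (O * K))%:E <=
   \int[mu]_(x in D) (multilinear_kernel mu rho f x `^ q * (rho x `^ (q * b - 1))%:E))%E.
Proof.
move=> KE; have LL0 : 0 < L * L by rewrite mulr_gt0.
have [mrho O0 polar] := grho; have mD := measurable_gauge_gt0 grho.
have q0 : 0 < q by exact: lt_trans q1.
have Gm : 0 < Gamma m%:R :> R by apply: Gamma_gt0; rewrite ltr0n.
pose A := O ^+ m * P * window_gamma k b / Gamma m%:R.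
have A0 : 0 <= A.
  apply: divr_ge0; last exact: ltW.
  apply: mulr_ge0; last exact: window_gamma_ge0.
  by apply: mulr_ge0 => //; exact/exprn_ge0/ltW.
pose g r : R := A `^ q * (L * L) `^ (- e) * (r `^ (- e - 1) * \1_(`]L * L, +oo[%classic) r).
have mt : measurable_fun setT (fun r : R => r `^ (- e - 1) * \1_(`]L * L, +oo[%classic) r).
  by apply: measurable_funM => //; exact: measurable_powR.
have mg : measurable_fun setT g by exact: measurable_funM.
have g0 r : 0 <= g r by rewrite !mulr_ge0 ?powR_ge0.
apply: (@le_trans _ _ (\int[mu]_(x in D) (g (rho x))%:E)%E).
  rewrite (polar (EFin \o g))//; [|exact/measurable_EFinP].
  rewrite /g /comp; under eq_integral do rewrite EFinM.
  rewrite ge0_integralZl_EFin ?mulr_ge0 ?powR_ge0//; last 2 first.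
  - by move=> r _; rewrite lee_fin mulr_ge0 ?powR_ge0.
  - by apply: measurable_funTS; apply/measurable_EFinP.
  have -> : (\int[leb]_(r in `]0%R, +oo[) (r `^ (- e - 1) * \1_(`]L * L, +oo[%classic) r)%:E
      = ((L * L) `^ (- e) * K)%:E)%E.
    rewrite -KE// integral_mkcond [RHS]integral_mkcond; apply: eq_integral => r _.
    rewrite !patchE indicE.
    have [r1|r1] := boolP (r \in (`]L * L, +oo[%classic : set R)); last by rewrite mulr0 if_same.
    rewrite mulr1 ifT//; move: r1; rewrite !inE/= !in_itv/= !andbT.
    exact: lt_trans.
  rewrite -!EFinM lee_fin le_eqVlt; apply/orP; left; apply/eqP.
  by rewrite opprD powRD ?(gt_eqF LL0) ?implybT// /A; ring.
apply: ge0_le_integral => //.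
- by move=> x _; rewrite lee_fin.
- by apply: measurable_funTS; apply/measurable_EFinP; exact: measurableT_comp mg mrho.
- apply: measurable_funTS; apply: emeasurable_funM.
    by apply: (measurableT_comp (measurable_poweR q)); exact: measurable_multilinear_kernel.
  by apply/measurable_EFinP; exact: measurable_powR_comp.
move=> x /= x0; rewrite /g indicE.
have [r1|r1] := boolP (rho x \in (`]L * L, +oo[%classic : set R)); last first.
  by rewrite !mulr0 mule_ge0 ?poweR_ge0 ?lee_fin ?powR_ge0.
move: r1; rewrite inE/= in_itv/= andbT mulr1 => Lx.
apply: (@le_trans _ _ ((A * ((L * L * rho x)^-1 `^ (e / q) * rho x `^ (- b)))%:E `^ q *
    (rho x `^ (q * b - 1))%:E)%E).
  rewrite poweR_EFin -EFinM lee_fin le_eqVlt; apply/orP; left; apply/eqP.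
  have Li : 0 <= (L * L)^-1 by rewrite invr_ge0 ltW.
  have xi : 0 <= (rho x)^-1 by rewrite invr_ge0 ltW.
  have y0 := mulr_ge0 (powR_ge0 (L * L)^-1 (e / q)) (powR_ge0 (rho x)^-1 (e / q)).
  rewrite invfM (powRM _ Li xi) [in RHS](powRM _ A0 (mulr_ge0 y0 (powR_ge0 _ _))).
  rewrite [in RHS](powRM _ y0 (powR_ge0 _ _)) [in RHS](powRM _ (powR_ge0 _ _) (powR_ge0 _ _)).
  rewrite -!powRrM divfK ?gt_eqF//.
  rewrite -[(L * L)^-1](powR_inv1 (ltW LL0)) -[(rho x)^-1](powR_inv1 (ltW x0)) -!powRrM !mulN1r.
  rewrite -!mulrA; congr (_ * (_ * _)).
  rewrite -!powRD ?(gt_eqF x0) ?implybT//; congr (_ `^ _); ring.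
apply: lee_wpmul2r; first by rewrite lee_fin powR_ge0.
apply: gt0_ler_poweR; rewrite ?(ltW q0)//.
- rewrite in_itv/= leey andbT lee_fin; apply: mulr_ge0 => //.
  by rewrite mulr_ge0 ?powR_ge0.
- rewrite in_itv/= leey andbT; apply: integral_ge0 => y _; rewrite lee_fin.
  by rewrite mulr_ge0 ?invr_ge0 ?exprn_ge0 ?prodr_ge0 ?addr_ge0 ?sumr_ge0.
apply: (le_trans _ (multilinear_kernel_ge Lx)).
rewrite lee_fin le_eqVlt; apply/orP; left; apply/eqP.
by rewrite /A; ring.
Qed.

End kernel_lower.

(** * Bounds for the operator on the Heisenberg group *)

Section hilbert_norm.
Variables (R : realType) (n m : nat).
Local Notation H := (heisenberg R n).
Local Notation Q := ((hdim n)%:R : R).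
Local Notation mu := (hmeasure R n).
Local Notation O := (omega1 R n).
Local Notation rho := (@hrho R n).
Local Notation D := [set x : H | (0 < rho x)%R].

Lemma wLnorm_hpowerE (p c : R) (g : H -> \bar R) : measurable_fun setT g ->
  wLnorm p (hpower c) g =
  ((\int[mu]_(x in D) (`|g x| `^ p * (rho x `^ (c / Q))%:E)) `^ p^-1)%E.
Proof.
move=> mg; suff E : (\int[mu]_x (`|g x| `^ p * (hpower c x)%:E) =
    \int[mu]_(x in D) (`|g x| `^ p * (rho x `^ (c / Q))%:E))%E by rewrite /wLnorm E.
rewrite -(ge0_integral_gauge_gt0 (@gauge_heisenberg R n) (@hrho_ge0 R n) (@hrho_null R n)).
- by apply: eq_integral => x _; rewrite hpowerE.
- apply: emeasurable_funM.
    by apply: (measurableT_comp (measurable_poweR p)); exact: measurableT_comp.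
  by apply/measurable_EFinP; apply: measurable_powR_comp; exact: measurable_hrho.
- by move=> x; rewrite mule_ge0 ?poweR_ge0 ?lee_fin ?powR_ge0.
Qed.

Lemma hilbert3E (f : 'I_m -> H -> R) : hilbert3 f = multilinear_kernel mu rho f.
Proof. by []. Qed.

(** Reduces the upper bound to nonnegative functions, at no cost since the norms of the f_j depend
    on their absolute values only. *)
Lemma le_abse_multilinear_kernel (f : 'I_m -> H -> R) x :
  (forall j, measurable_fun setT (f j)) ->
  (`|multilinear_kernel mu rho f x| <=
   multilinear_kernel mu rho (fun j y => `|f j y|%R) x)%E.
Proof.
move=> mf; rewrite /multilinear_kernel.
apply: (le_trans (le_abse_integral _ measurableT _)).
  apply/measurable_EFinP; apply: measurable_funM.
    by apply: measurable_bigprod => j; exact: measurableT_comp (mf j) (measurable_tnth j).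
  pose S (y : m.-tuple H) := rho x + \sum_(j < m) rho (tnth y j).
  have -> : (fun y => (S y ^+ m)^-1) = (fun y => S y `^ (- m%:R)).
    apply/funext => y; rewrite powR_invn// addr_ge0 ?hrho_ge0// sumr_ge0// => j _.
    exact: hrho_ge0.
  apply: measurable_powR_comp; apply: measurable_funD => //.
  apply: measurable_bigsum => j.
  exact: measurableT_comp (@measurable_hrho R n) (measurable_tnth j).
rewrite le_eqVlt; apply/orP; left; apply/eqP; apply: eq_integral => y _ /=.
congr EFin; rewrite normrM normr_prod; congr (_ * _).
rewrite ger0_norm// invr_ge0 exprn_ge0// addr_ge0 ?hrho_ge0// sumr_ge0// => j _.
exact: hrho_ge0.
Qed.

Variables (q b : R) (qs a c : 'I_m -> R).
Hypotheses (m0 : (0 < m)%N) (q1 : 1 < q) (qs1 : forall j, 1 < qs j).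
Hypothesis qE : \sum_(j < m) (qs j)^-1 = q^-1.
Hypotheses (b0 : 0 < b) (a0 : forall j, 0 < a j).
Hypothesis abE : b + \sum_(j < m) a j = m%:R.
Hypothesis cE : forall j, c j / Q = qs j * (1 - a j) - 1.
Variable alpha : R.
Hypothesis alphaE : alpha / Q = q * b - 1.

Let q0 : 0 < q. Proof. exact: lt_trans q1. Qed.
Let qs0 j : 0 < qs j. Proof. exact: lt_trans (qs1 j). Qed.

Lemma hilbert3_upper (f : 'I_m -> H -> R) :
  (forall j, [/\ measurable_fun setT (f j), radial (f j) &
     (0 < wLnorm (qs j) (hpower (c j)) (EFin \o f j) < +oo)%E]) ->
  (wLnorm q (hpower alpha) (hilbert3 f) /
     \prod_(j < m) wLnorm (qs j) (hpower (c j)) (EFin \o f j) <=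
   (O ^+ m * Gamma b * (\prod_(j < m) Gamma (a j)) / Gamma m%:R)%:E)%E.
Proof.
move=> Hf.
have mf j : measurable_fun setT (f j) by have [] := Hf j.
have maf j : measurable_fun setT (fun y => `|f j y|) by exact: measurableT_comp.
pose I j := (\int[mu]_(x in D) (`|f j x| `^ qs j * rho x `^ (qs j * (1 - a j) - 1))%:E)%E.
have wE j : wLnorm (qs j) (hpower (c j)) (EFin \o f j) = (I j `^ (qs j)^-1)%E.
  rewrite wLnorm_hpowerE; last exact/measurable_EFinP.
  by rewrite cE.
have I0 j : (0 <= I j)%E by apply: integral_ge0 => x _; rewrite lee_fin mulr_ge0 ?powR_ge0.
have qsi j : (qs j)^-1 != 0 by rewrite invr_eq0 gt_eqF.
have Ifin j : I j \is a fin_num.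
  rewrite ge0_fin_numE//; have [_ _ /andP[_]] := Hf j.
  by rewrite wE; exact: lty_poweRy.
have Igt0 j : 0 < fine (I j).
  have [_ _ /andP[+ _]] := Hf j; rewrite wE => /(gt0_poweR _ (I0 j)) h.
  have h0 : (0 < (qs j)^-1) by rewrite invr_gt0.
  by rewrite fine_gt0//; rewrite (h h0)/= -ge0_fin_numE.
have nE j : wLnorm (qs j) (hpower (c j)) (EFin \o f j) = (fine (I j) `^ (qs j)^-1)%:E.
  by rewrite wE -{1}(fineK (Ifin j)).
under eq_bigr do rewrite nE.
pose N := \prod_(j < m) fine (I j) `^ (qs j)^-1; rewrite prodEFin -/N.
have N0 : 0 < N.
  apply: prodr_gt0 => j _.
  exact: powR_gt0 (Igt0 j).
have Gm : 0 < Gamma m%:R :> R by apply: Gamma_gt0; rewrite ltr0n.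
set C := O ^+ m * _ * _ / _.
have C0 : 0 <= C.
  apply: divr_ge0; last exact: ltW.
  apply: mulr_ge0; last by apply: prodr_ge0 => j _; exact: ltW (Gamma_gt0 (a0 j)).
  apply: mulr_ge0; last exact: ltW (Gamma_gt0 b0).
  exact/exprn_ge0/ltW/omega1_gt0.
rewrite inver (gt_eqF N0) lee_pdivrMr// -EFinM.
have In j : (I j <= (fine (I j))%:E)%E by rewrite fineK.
have H1 := multilinear_kernel_upper (@gauge_heisenberg R n) (@hrho_ge0 R n) (@hrho_null R n)
  m0 q1 qs1 qE b0 a0 abE maf (fun j x => normr_ge0 _) Igt0 In.
have mk g : (forall j, measurable_fun setT (g j)) ->
    measurable_fun setT (@multilinear_kernel _ _ _ mu rho m g).
  exact: (measurable_multilinear_kernel (@gauge_heisenberg R n) (@hrho_ge0 R n)).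
rewrite wLnorm_hpowerE; last exact: (mk f).
rewrite alphaE hilbert3E -/C in H1 *.
have H2 : (\int[mu]_(x in D) (`|multilinear_kernel mu rho f x| `^ q * (rho x `^ (q * b - 1))%:E) <=
    (C `^ q * \prod_(j < m) fine (I j) `^ (q / qs j))%:E)%E.
  apply: le_trans H1; have mD := measurable_gauge_gt0 (@gauge_heisenberg R n).
  have mw : measurable_fun setT (fun x : H => (rho x `^ (q * b - 1))%:E).
    by apply/measurable_EFinP; apply: measurable_powR_comp; exact: measurable_hrho.
  apply: ge0_le_integral => //.
  - by move=> x _; rewrite mule_ge0 ?poweR_ge0 ?lee_fin ?powR_ge0.
  - apply: measurable_funTS; apply: emeasurable_funM => //.
    apply: (measurableT_comp (measurable_poweR q)); apply: measurableT_comp => //.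
    exact: mk.
  - apply: measurable_funTS; apply: emeasurable_funM => //.
    by apply: (measurableT_comp (measurable_poweR q)); exact: mk.
  move=> x _; apply: lee_wpmul2r; first by rewrite lee_fin powR_ge0.
  have h := le_abse_multilinear_kernel x mf.
  apply: gt0_ler_poweR => //; rewrite ?(ltW q0)// in_itv/= leey andbT//.
  exact: le_trans h.
have qi0 : 0 <= q^-1 by rewrite invr_ge0 ltW.
apply: (le_trans (gt0_ler_poweR qi0 _ _ H2)).
- rewrite in_itv/= leey andbT; apply: integral_ge0 => x _.
  by rewrite mule_ge0 ?poweR_ge0 ?lee_fin ?powR_ge0.
- rewrite in_itv/= leey andbT lee_fin mulr_ge0 ?powR_ge0//.
  by apply: prodr_ge0 => j _; exact: powR_ge0.
rewrite poweR_EFin lee_fin le_eqVlt; apply/orP; left; apply/eqP.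
rewrite powRM ?powR_ge0//; last by apply: prodr_ge0 => j _; exact: powR_ge0.
rewrite -powRrM divff ?gt_eqF// powRr1//; congr (_ * _).
rewrite -prod_powR; last by move=> j; exact: powR_ge0.
by apply: eq_bigr => j _; rewrite -powRrM mulrAC divff ?mul1r// gt_eqF.
Qed.

(** The norms of the test functions are (O K)^(1/q_j), with product (O K)^(1/q), and the same factor
    occurs in the norm of the image. After cancellation e survives only in the power of (k+1)^2. *)
Lemma hilbert3_lower (k : nat) (e : R) : 0 < e ->
  exists2 f : 'I_m -> H -> R,
    (forall j, [/\ measurable_fun setT (f j), radial (f j) &
      (0 < wLnorm (qs j) (hpower (c j)) (EFin \o f j) < +oo)%E]) &
    ((O ^+ m * (\prod_(j < m) window_gamma k (a j)) * window_gamma k b / Gamma m%:R *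
       (k.+1%:R * k.+1%:R) `^ (- (e + e) / q))%:E <=
     wLnorm q (hpower alpha) (hilbert3 f) /
       \prod_(j < m) wLnorm (qs j) (hpower (c j)) (EFin \o f j))%E.
Proof.
move=> e0; pose f j (x : H) := tail_power (a j - 1 - e / qs j) (rho x).
have mf j : measurable_fun setT (f j).
  exact: measurableT_comp (measurable_tail_power _) (@measurable_hrho R n).
have [K K0 KE] := integral_powR_tail e0.
have K1 : (\int[@lebesgue_measure R]_(r in `]1%R, +oo[) (r `^ (- e - 1))%:E = K%:E)%E.
  by rewrite KE// powR1 mul1r.
have O0 := omega1_gt0 R n; have OK0 : 0 < O * K by rewrite mulr_gt0.
have nE j : wLnorm (qs j) (hpower (c j)) (EFin \o f j) = ((O * K) `^ (qs j)^-1)%:E.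
  rewrite wLnorm_hpowerE; last exact/measurable_EFinP.
  rewrite -poweR_EFin -(integral_tail_power (@gauge_heisenberg R n) (a j) (qs0 j) K1).
  congr (_ `^ _)%E; apply: eq_integral => x _; rewrite cE /=.
  by rewrite ger0_norm// tail_power_ge0.
exists f.
  move=> j; split => //; first by move=> x y xy; rewrite /f /hrho xy.
  by rewrite nE lte_fin powR_gt0// ltry.
under [X in (_ <= _ / X)%E]eq_bigr do rewrite nE.
rewrite prodEFin prod_powR_exponents// qE inver gt_eqF ?powR_gt0// lee_pdivlMr ?powR_gt0// -EFinM.
rewrite wLnorm_hpowerE; last first.
  exact: (measurable_multilinear_kernel (@gauge_heisenberg R n) (@hrho_ge0 R n) mf).
rewrite alphaE hilbert3E.
have := multilinear_kernel_lower (@gauge_heisenberg R n) (@hrho_ge0 R n) (@hrho_null R n)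
  k m0 q1 qs1 qE b0 a0 abE e0 KE.
set A := O ^+ m * _ * _ / _; move=> H1.
have kE x : (`|multilinear_kernel mu rho f x| = multilinear_kernel mu rho f x)%E.
  rewrite gee0_abs//; apply: integral_ge0 => y _; rewrite lee_fin.
  rewrite mulr_ge0 ?prodr_ge0 ?invr_ge0 ?exprn_ge0//; first by move=> j _; exact: tail_power_ge0.
  by rewrite addr_ge0 ?hrho_ge0// sumr_ge0// => j _; exact: hrho_ge0.
under eq_integral do rewrite kE.
have A0 : 0 <= A.
  apply: divr_ge0; last by apply/ltW/Gamma_gt0; rewrite ltr0n.
  apply: mulr_ge0; last exact: window_gamma_ge0.
  apply: mulr_ge0; first exact/exprn_ge0/ltW.
  by apply: prodr_ge0 => j _; exact: window_gamma_ge0.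
have qi0 : 0 <= q^-1 by rewrite invr_ge0 ltW.
apply: le_trans (gt0_ler_poweR qi0 _ _ H1).
- rewrite poweR_EFin lee_fin le_eqVlt; apply/orP; left; apply/eqP.
  rewrite [in RHS](powRM _ (mulr_ge0 (powR_ge0 _ _) (powR_ge0 _ _)) (ltW OK0)).
  rewrite [in RHS](powRM _ (powR_ge0 _ _) (powR_ge0 _ _)).
  by rewrite -!powRrM divff ?gt_eqF// powRr1.
- by rewrite in_itv/= leey andbT lee_fin !mulr_ge0 ?powR_ge0 ?(ltW O0) ?(ltW K0).
- rewrite in_itv/= leey andbT; apply: integral_ge0 => x _.
  by rewrite -kE mule_ge0 ?poweR_ge0 ?lee_fin ?powR_ge0.
Qed.

End hilbert_norm.

(** * The exact operator norm *)

Section hilbert_opnorm.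
Variables (R : realType) (n m : nat).
Local Notation Q := ((hdim n)%:R : R).
Local Notation O := (omega1 R n).

Lemma cvg_bigprod (I : Type) (s : seq I) (u : I -> R^nat) (l : I -> R) :
  (forall i, u i k @[k --> \oo] --> l i) ->
  (\prod_(i <- s) u i k) @[k --> \oo] --> \prod_(i <- s) l i.
Proof.
move=> ul; elim: s => [|i s IH].
  by rewrite big_nil; under eq_fun do rewrite big_nil; exact: cvg_cst.
by rewrite big_cons; under eq_fun do rewrite big_cons; exact: cvgM.
Qed.

Variables (q b alpha : R) (qs a c : 'I_m -> R).
Hypotheses (m0 : (0 < m)%N) (q1 : 1 < q) (qs1 : forall j, 1 < qs j).
Hypothesis qE : \sum_(j < m) (qs j)^-1 = q^-1.
Hypotheses (b0 : 0 < b) (a0 : forall j, 0 < a j).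
Hypothesis abE : b + \sum_(j < m) a j = m%:R.
Hypothesis cE : forall j, c j / Q = qs j * (1 - a j) - 1.
Hypothesis alphaE : alpha / Q = q * b - 1.

(* Letting the exponent e of the test functions tend to 0 first makes the
   factor (L^2)^(-2e/q) disappear; only then the windows exhaust the half-line. *)
Lemma hilbert3_opnorm :
  radial_opnorm (@hilbert3 R n m) qs (fun j => hpower (c j)) q (hpower alpha) =
  (O ^+ m * Gamma b * (\prod_(j < m) Gamma (a j)) / Gamma m%:R)%:E.
Proof.
apply/eqP; rewrite eq_le; apply/andP; split.
  apply: ge_ereal_sup => _ [f Hf <-].
  exact: (hilbert3_upper m0 q1 qs1 qE b0 a0 abE cE alphaE Hf).
set s := radial_opnorm _ _ _ _ _.
have q0 : 0 < q by exact: lt_trans q1.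
pose A k := O ^+ m * (\prod_(j < m) window_gamma k (a j)) * window_gamma k b / Gamma m%:R.
have A0 k : 0 <= A k.
  apply: divr_ge0; last by apply/ltW/Gamma_gt0; rewrite ltr0n.
  apply: mulr_ge0; last exact: window_gamma_ge0.
  apply: mulr_ge0; first exact/exprn_ge0/ltW/omega1_gt0.
  by apply: prodr_ge0 => j _; exact: window_gamma_ge0.
have As k : ((A k)%:E <= s)%E.
  have Ak0 : (0 <= (A k)%:E)%E by rewrite lee_fin.
  apply/(lee_mul01Pr _ Ak0) => r /andP[r0 r1].
  pose LL : R := k.+1%:R * k.+1%:R.
  have LL0 : 0 < LL by rewrite mulr_gt0.
  have l0 : 0 <= ln LL by rewrite ln_ge0// mulr_ege1// ler1n.
  have l1 : 0 < 1 + ln LL by rewrite ltr_pwDl.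
  have lr : 0 < - ln r by rewrite oppr_gt0 ln_lt0// r0.
  (* Chosen so that LL^(-2e/q) = r^(ln LL / (1 + ln LL)) >= r. The summand 1 in the denominator
     avoids a division by zero at k = 0, where LL = 1. *)
  pose e := q / 2 * (- ln r / (1 + ln LL)).
  have e0 : 0 < e by rewrite !mulr_gt0// invr_gt0.
  have [f Hf fE] := hilbert3_lower m0 q1 qs1 qE b0 a0 abE cE alphaE k e0.
  apply: (@le_trans _ _ (A k * LL `^ (- (e + e) / q))%:E).
    rewrite -EFinM lee_fin mulrC ler_wpM2l//.
    rewrite /powR (gt_eqF LL0) -[leLHS]lnK ?posrE// ler_expR.
    rewrite (_ : - (e + e) / q * ln LL = ln r * (ln LL / (1 + ln LL))); last first.
      by rewrite /e; field; rewrite !gt_eqF.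
    rewrite ler_niMr ?ler_pdivrMr//; last by rewrite mul1r lerDr.
    by rewrite -oppr_ge0 ltW.
  apply: (le_trans fE); apply: ereal_sup_ubound; exists f => //.
have cA : (A k)%:E @[k --> \oo] -->
    (O ^+ m * Gamma b * (\prod_(j < m) Gamma (a j)) / Gamma m%:R)%:E.
  apply: cvg_EFin; first exact: nearW.
  rewrite (mulrAC (O ^+ m)).
  apply: cvgM; last exact: cvg_cst.
  apply: cvgM; last exact: cvg_window_gamma.
  apply: cvgM; first exact: cvg_cst.
  by apply: cvg_bigprod => j; exact: cvg_window_gamma.
rewrite -(cvg_lim _ cA)//; apply: lime_le; first by apply/cvg_ex; eexists; exact: cA.
exact: nearW.
Qed.

End hilbert_opnorm.

Theorem corollary4p3 (R : realType) (n m : nat) (q alpha : R)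
    (qs alphas : 'I_m -> R)
    (hn : (1 <= n)%N) (hm : (1 <= m)%N)
    (hq : 1 < q) (hqs : forall j, 1 < qs j)
    (hqE : 1 / q = \sum_(j < m) 1 / qs j)
    (halphaE : alpha = \sum_(j < m) alphas j)
    (hpos : forall j,
      0 < - (alphas j / q) - (hdim n)%:R / qs j + (hdim n)%:R)
    (hneg : - (alpha / q) - (hdim n)%:R / q < 0) :
  radial_opnorm (@hilbert3 R n m)
    qs (fun j => hpower (qs j * alphas j / q)) q (hpower alpha)
  = (omega_Q R n ^+ m *
     (Gamma ((alpha + (hdim n)%:R) / (q * (hdim n)%:R)) *
      (\prod_(j < m) Gamma (1 - alphas j / (q * (hdim n)%:R) - 1 / qs j)) /
      ((hdim n)%:R ^+ m * Gamma m%:R))%:E)%E.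
Proof.
have q0 : 0 < q by exact: lt_trans hq.
have qs0 j : 0 < qs j by exact: lt_trans (hqs j).
have Q0 : 0 < (hdim n)%:R :> R by rewrite ltr0n.
set Q : R := (hdim n)%:R in Q0 hpos hneg *.
have Qn : Q != 0 by rewrite gt_eqF.
have qn : q != 0 by rewrite gt_eqF.
have qsn j : qs j != 0 by rewrite gt_eqF.
(* The assumptions [hneg] and [hpos] state precisely that Q b > 0 and Q a_j > 0. *)
pose b := (alpha + Q) / (q * Q).
pose a j := 1 - alphas j / (q * Q) - 1 / qs j.
have qE : \sum_(j < m) (qs j)^-1 = q^-1.
  by rewrite -[RHS]mul1r hqE; apply: eq_bigr => j _; rewrite mul1r.
have b0 : 0 < b.
  rewrite divr_gt0 ?mulr_gt0//; move: hneg.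
  by rewrite -mulNr -mulrBl pmulr_llt0 ?invr_gt0// -opprD oppr_lt0.
have a0 j : 0 < a j.
  rewrite -(pmulr_rgt0 _ Q0); have := hpos j; congr (0 < _).
  by rewrite /a; field; rewrite qn Qn qsn.
(* Both balance conditions are used: the sum of the a_j is m - alpha / (qQ) - 1 / q, which is m -
   b. *)
have abE : b + \sum_(j < m) a j = m%:R.
  rewrite /a !sumrB -mulr_suml -halphaE -hqE sumr_const card_ord /b.
  by field; rewrite qn Qn.
have cE j : qs j * alphas j / q / Q = qs j * (1 - a j) - 1.
  by rewrite /a; field; rewrite qn Qn qsn.
have alphaE : alpha / Q = q * b - 1 by rewrite /b; field; rewrite qn Qn.
rewrite (hilbert3_opnorm hm hq hqs qE b0 a0 abE cE alphaE).
(* The powers of Q in omega_Q^m and in the denominator cancel, leaving the m-th power of the gauge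
   constant. *)
have -> : omega_Q R n = (Q * omega1 R n)%:E by rewrite EFinM omega1E.
rewrite -EFin_expe -EFinM; congr EFin.
rewrite -[Gamma ((alpha + Q) / _)]/(Gamma b) exprMn.
have Qm : Q ^+ m != 0 by rewrite expf_neq0.
have Gm : Gamma m%:R != 0 :> R by rewrite gt_eqF// Gamma_gt0// ltr0n.
by field; rewrite Gm Qm.
Qed.
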